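(* Let $A$ be a bounded linear operator on a real or complex separable Banach space $Z$. Suppose that there exists a sequence $(z_n)_{n\in\mathbb{Z}}$ of vectors of $Z$ such that $Az_n=z_{n+1}$ for every $n\in\mathbb{Z}$, and such that the following properties hold: (a) $\overline{\mathrm{span}}\,[z_{-n};\ n\in\mathbb{Z}]=Z$; (b) there exists a finite subset $F$ of $\mathbb{Z}$ such that $\overline{\mathrm{span}}\,[z_{-n};\ n\in\mathbb{Z}\setminus F]\neq Z$; (c) the series $\sum_{n\in\mathbb{Z}} z_{-n}$ is unconditionally convergent in $Z$; and moreover $z_r=0$ for some $r\in\mathbb{Z}$. Then $A$ is universal for ergodic systems.
   Context: A dynamical system $(X,\mathcal{B},\mu;T)$ consists of a probability space $(X,\mathcal{B},\mu)$ and a $\mu$-preserving measurable transformation $T$ of $X$ (not necessarily invertible). A standard Lebesgue probability space is a probability space isomorphic (mod null sets) to $[0,1]$ with Lebesgue measure. Isomorphism of dynamical systems means measure-theoretic isomorphism (mod null sets). $\mathcal{B}_Z$ denotes the Borel $\sigma$-field of a Banach space $Z$; a Borel probability measure $\nu$ on $Z$ has full support if $\nu(U)>0$ for every non-empty open $U\subseteq Z$. A bounded operator $A$ on $Z$ is universal for ergodic systems if for every ergodic dynamical system $(X,\mathcal{B},\mu;T)$ on a standard Lebesgue probability space there exists an $A$-invariant Borel probability measure $\nu$ on $Z$ with full support such that the dynamical systems $(X,\mathcal{B},\mu;T)$ and $(Z,\mathcal{B}_Z,\nu;A)$ are isomorphic. *)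

(* Defs.v *)
From mathcomp Require Import all_boot all_order all_algebra complex.
From mathcomp Require Import all_classical all_reals all_analysis.
From mathcomp Require Import measurable_realfun.
Set Implicit Arguments.
Unset Strict Implicit.
Unset Printing Implicit Defensive.
Import Order.TTheory GRing.Theory Num.Theory.
Import numFieldNormedType.Exports.

Local Open Scope classical_set_scope.
Local Open Scope ring_scope.

Definition bounded_operator (K : numFieldType) (Z : normedModType K)
    (A : Z -> Z) : Prop :=
  exists M : K, forall x, `|A x| <= M * `|x|.

Definition separable (Z : topologicalType) : Prop :=
  exists D : set Z, countable D /\ dense D.

Definition linear_span (K : numFieldType) (Z : lmodType K) (S : set Z) :
    set Z :=
  [set v | exists (n : nat) (a : 'I_n -> K) (w : 'I_n -> Z),
    (forall i, S (w i)) /\ v = \sum_(i < n) a i *: w i].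

Definition closed_span (K : numFieldType) (Z : normedModType K) (S : set Z) :
    set Z :=
  closure (linear_span S).

(* The series converges along every enumeration of its index set int. *)
Definition unconditionally_convergent (K : numFieldType)
    (Z : normedModType K) (u : int -> Z) : Prop :=
  forall s : nat -> int, bijective s -> cvgn (series (fun k => u (s k))).

Definition measure_preserving d (X : measurableType d) (R : realType)
    (mu : probability X R) (T : X -> X) : Prop :=
  measurable_fun setT T /\
  forall B, measurable B -> mu (T @^-1` B) = mu B.

Definition ergodic d (X : measurableType d) (R : realType)
    (mu : probability X R) (T : X -> X) : Prop :=
  measure_preserving mu T /\
  forall B, measurable B -> T @^-1` B = B -> mu B = 0%E \/ mu B = 1%E.

(* phi is an isomorphism mod null sets between (X, mu) and (Y, nu), carried by
   the conull sets X0 and Y0. Measurability refers to the completions of the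
   sigma-algebras (the sets of completed_algebra_gen, on which the outer
   measure is the completed measure), so that a Borel space and its completion
   are isomorphic. *)
Definition mod0_isomorphism d (X : measurableType d) d' (Y : measurableType d')
    (R : realType) (mu : {measure set X -> \bar R})
    (nu : {measure set Y -> \bar R})
    (X0 : set X) (Y0 : set Y) (phi : X -> Y) : Prop :=
  [/\ mu.-negligible (~` X0),
      nu.-negligible (~` Y0),
      set_bij X0 Y0 phi,
      forall B, B `<=` Y0 ->
        (completed_algebra_gen nu B <->
         completed_algebra_gen mu (X0 `&` phi @^-1` B))
    & forall B, B `<=` Y0 -> completed_algebra_gen nu B ->
        (mu^* (X0 `&` phi @^-1` B))%mu = (nu^* B)%mu].

(* The unit interval is rendered as the real line carrying the restriction of
   Lebesgue measure to [0, 1], which is the same space mod null sets. *)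
Definition standard_lebesgue d (X : measurableType d) (R : realType)
    (mu : probability X R) : Prop :=
  exists X0 Y0 phi, mod0_isomorphism mu
    (mrestr (@lebesgue_measure R) (measurable_itv `[0%R, 1%R]))
    X0 Y0 phi.

Definition isomorphic_systems d (X : measurableType d) d'
    (Y : measurableType d') (R : realType)
    (mu : probability X R) (T : X -> X)
    (nu : probability Y R) (S : Y -> Y) : Prop :=
  exists X0 Y0 phi,
    [/\ mod0_isomorphism mu nu X0 Y0 phi,
        set_fun X0 X0 T,
        set_fun Y0 Y0 S
      & forall x, X0 x -> phi (T x) = S (phi x)].

Definition full_support (Z : ptopologicalType) (R : realType)
    (nu : probability (g_sigma_algebraType (@open Z)) R) : Prop :=
  forall U : set Z, open U -> U !=set0 -> (0 < nu U)%E.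

Definition universal_for_ergodic_systems (R : realType) (K : numFieldType)
    (Z : completeNormedModType K) (A : Z -> Z) : Prop :=
  forall (d : measure_display) (X : measurableType d) (mu : probability X R)
    (T : X -> X),
    standard_lebesgue mu -> ergodic mu T ->
    exists nu : probability (g_sigma_algebraType (@open Z)) R,
      [/\ measure_preserving nu A,
          full_support nu
        & isomorphic_systems mu T nu A].

(* Main.v *)
Require Import Defs.
From mathcomp Require Import all_boot all_order all_algebra complex.
From mathcomp Require Import all_classical all_reals all_analysis.
From mathcomp Require Import measurable_realfun lra zify ring.
Import Order.TTheory GRing.Theory Num.Theory.
Import numFieldNormedType.Exports.
Local Open Scope classical_set_scope.
Local Open Scope ring_scope.

(* Since [z r = 0], the nonzero [z n] form a backward orbit [w 0, w 1, ...] with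
   [A (w 0) = 0] and [A (w k.+1) = w k], so [x |-> \sum_k f (T^k x) w k]
   intertwines [T] and [A] for every scalar function [f]. The required [f] is
   built as a limit of finitely valued functions. Each step overrides [f] on a
   thin tower so that the sum comes close to a prescribed vector on a set of
   positive measure (full support), and then adds a tiny multiple of the
   indicator of a set [B] that can be read off from the sum. By (b) the distance
   [p] to the closed span of the [w k], [k >= L], is not identically zero; if [B]
   has long return times then [p] along the orbit reveals whether [T^k0 x] lies
   in [B], where [k0] is the least [k] with [p (w k) != 0]. As the sets [B]
   separate points, the sum determines [T^k0 x]; since the head of the series is
   [f x * w 0], it then determines [T^(k0-1) x], ..., [x] in turn. An injective
   map on a standard space is an isomorphism onto its image by Lusin's
   theorem. *)

Set Implicit Arguments.
Unset Strict Implicit.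
Unset Printing Implicit Defensive.

(** * Completed measurable sets and isomorphisms mod 0 *)

(** Every stage has to survive all later ones. A stage therefore ends by fixing a tolerance [eta],
    at most half the previous one: the points at which some later stage makes a large change have
    total measure at most [2 * eta], and everywhere else the later stages together move the sum by
    at most [2 * eta]. Two such points with equal limits are then [4 * eta] close at that stage,
    which is why [4 * eta] is kept within the decoding margin and below the measure of the set
    steered to the target. Only the sums are shown to converge, almost everywhere by Borel-Cantelli;
    no limit of the functions [f n] is formed. As the time of settling depends on the point, each
    target and each separating set is treated at infinitely many stages. Finite ranges serve twice.
    Unconditional convergence makes tails small uniformly over all coefficients drawn from one
    finite set, and finitely many values have a positive gap, so that an approximate equality
    becomes exact. *)

Section completed_sets.
Context d (X : measurableType d) (R : realType) (mu : {measure set X -> \bar R}).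
Local Open Scope ereal_scope.

(** A completed set has to be presented as a measurable set united with a null set, so a measurable
    null cover of the part of [A] outside [B] is first removed from [A]. *)
Lemma completed_mod0 (A B : set X) : measurable A ->
  mu.-negligible (A `\` B) -> mu.-negligible (B `\` A) ->
  completed_algebra_gen mu B.
Proof.
move=> mA [N [mN N0 AN]] nBA.
exists (A `\` N); first exact: measurableD.
exists ((A `&` B `&` N) `|` (B `\` A)).
  apply: negligibleU => //; by exists N; split => // x [].
apply/seteqP; split => x /=.
- move=> [[Ax nNx]|[[[]//]|[]//]].
  by apply: contrapT => nBx; apply: nNx; apply: AN.
- move=> Bx; have [Ax|nAx] := pselect (A x); last by right; right.
  by have [Nx|nNx] := pselect (N x); [right; left|left].
Qed.

Lemma completed_inner (B : set X) : completed_algebra_gen mu B ->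
  exists A, [/\ measurable A, A `<=` B & mu.-negligible (B `\` A)].
Proof.
move=> [A mA [N nN <-]]; exists A; split => //.
by apply: negligibleS nN => x [[]].
Qed.

Lemma completed_negligible (N : set X) : mu.-negligible N ->
  completed_algebra_gen mu N.
Proof. by move=> nN; exists set0 => //; exists N => //; rewrite set0U. Qed.

Lemma negligible_mu_ext (N : set X) : mu.-negligible N -> (mu^*)%mu N = 0.
Proof.
move=> [M [mM M0 NM]]; apply/eqP; rewrite eq_le; apply/andP; split.
  by rewrite -M0 -(measurable_mu_extE mu mM) le_mu_ext.
exact: (mu_ext_ge0 (measure_ge0 mu)).
Qed.

Lemma mu_ext_mod0 (A B : set X) : measurable A -> A `<=` B ->
  mu.-negligible (B `\` A) -> (mu^*)%mu B = mu A.
Proof.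
move=> mA AB nBA; apply/eqP; rewrite eq_le; apply/andP; split; last first.
  by rewrite -(measurable_mu_extE mu mA) le_mu_ext.
have := outer_measureU2 ((mu^*)%mu : {outer_measure set X -> \bar R}) A (B `\` A).
rewrite setDUK// => /le_trans; apply.
have h := negligible_mu_ext nBA.
rewrite -[leRHS]adde0; apply: leeD.
  by rewrite -(measurable_mu_extE mu mA).
by rewrite le_eqVlt; apply/orP; left; apply/eqP; exact: h.
Qed.

Lemma mu_ext_le_measurable (A B : set X) (r : \bar R) : measurable A ->
  B `<=` A -> mu A <= r -> (mu^*)%mu B <= r.
Proof.
move=> mA BA; apply: le_trans.
by rewrite -(measurable_mu_extE mu mA) le_mu_ext.
Qed.

Lemma mu_ext_eq0 (B : set X) : completed_algebra_gen mu B ->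
  (mu^*)%mu B = 0 -> mu.-negligible B.
Proof.
move=> /completed_inner[A [mA AB nBA]]; rewrite (mu_ext_mod0 mA AB nBA) => A0.
by rewrite -(setDUK AB); apply: negligibleU => //; exact/negligibleP.
Qed.

End completed_sets.

(** * Regularity of completed sets in the unit interval *)

Section lebesgue_unit.
Context (R : realType).
Local Notation lam :=
  (mrestr (@lebesgue_measure R) (measurable_itv `[0%R, 1%R])).
Local Open Scope ereal_scope.

Lemma lebesgue_unit_lt_pinfty (A : set R) : measurable A ->
  lebesgue_measure (A `&` `[0%R, 1%R]) < +oo.
Proof.
move=> mA; apply: le_lt_trans (_ : lebesgue_measure `[0%R, 1%R]%classic < +oo).
  by apply: le_measure; rewrite ?inE//; exact: measurableI.
by rewrite lebesgue_measure_itv/= lte_fin ltr01 ltry.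
Qed.

Lemma completed_lebesgue_regular (G : set R) (eps : R) : (0 < eps)%R ->
  completed_algebra_gen lam G ->
  exists C V : set R, [/\ compact C, open V, C `<=` G `&` `[0%R, 1%R],
    G `&` `[0%R, 1%R] `<=` V & lebesgue_measure (V `\` C) < eps%:E].
Proof.
move=> e0 [A mA [N [M [mM M0 NM]] <-]].
have mI : measurable (`[0%R, 1%R]%classic : set R) by [].
have e20 : (0 < eps / 2)%R by rewrite divr_gt0.
have [C [cC CA CAe]] := lebesgue_regularity_inner (measurableI _ _ mA mI)
  (lebesgue_unit_lt_pinfty mA) e20.
(* The null part [N] need not be measurable, so the open set is taken around its measurable null
   cover [M]. *)
have mAM : measurable (A `|` M) by exact: measurableU.
have [V [oV AV VAe]] := lebesgue_regularity_outer (measurableI _ _ mAM mI)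
  (lebesgue_unit_lt_pinfty mAM) e20.
have mC : measurable C by apply: compact_measurable.
have mV : measurable V by exact: open_measurable.
exists C, V; split => //.
- by move=> x /CA[Ax Ix]; split => //; left.
- by move=> x [[Ax|/NM Mx] Ix]; apply: AV; split => //; [left|right].
have mD1 : measurable (V `\` ((A `|` M) `&` `[0%R, 1%R])).
  by apply: measurableD => //; exact: measurableI.
have mD2 : measurable ((A `&` `[0%R, 1%R]) `\` C).
  by apply: measurableD => //; exact: measurableI.
have mMI : measurable (M `&` `[0%R, 1%R]) by exact: measurableI.
rewrite (splitr eps) EFinD.
apply: le_lt_trans (lteD VAe CAe).
apply: le_trans (_ : _ <= lebesgue_measure
   ((V `\` ((A `|` M) `&` `[0%R, 1%R])) `|` ((A `&` `[0%R, 1%R]) `\` C)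
    `|` (M `&` `[0%R, 1%R]))) _.
  apply: le_measure; rewrite ?inE.
  - exact: measurableD.
  - by apply: measurableU => //; exact: measurableU.
  - move=> x [Vx nCx].
    have [[[Ax|Mx] Ix]|nx] := pselect (((A `|` M) `&` `[0%R, 1%R]%classic) x).
    + by left; right.
    + by right.
    + by left; left.
apply: le_trans (measureU2 _ _ _) _ => //.
  exact: measurableU.
apply: le_trans (leeD (measureU2 _ _ _) (lexx _)) _ => //.
rewrite -[leRHS]adde0; apply: leeD => //.
by rewrite le_eqVlt; apply/orP; left; apply/eqP; exact: M0.
Qed.

End lebesgue_unit.

(** * Lusin's theorem and small sets in a real coordinate *)

Section coordinates.
Context d (X : measurableType d) (R : realType) (mu : probability X R).
Local Notation lam :=
  (mrestr (@lebesgue_measure R) (measurable_itv `[0%R, 1%R])).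
Variables (X1 : set X) (Y1 : set R) (psi : X -> R).
Hypothesis iso : mod0_isomorphism mu lam X1 Y1 psi.
Local Open Scope ereal_scope.

Lemma coordinate_negligible (N : set R) : N `<=` Y1 -> lam.-negligible N ->
  mu.-negligible (X1 `&` psi @^-1` N).
Proof.
case: iso => _ _ _ iso_meas iso_mu NY nN.
have cN := completed_negligible nN.
apply: mu_ext_eq0; first exact/(iso_meas _ NY).
by rewrite (iso_mu _ NY cN); exact: negligible_mu_ext nN.
Qed.

(** [psi] is one-to-one on [X1], so pulling the image back gives [E] within [X1], which is
    measurable up to a null set. As [psi] respects only completions, the conclusion is about the
    completion too. *)
Lemma coordinate_completed (E : set X) : measurable E ->
  psi @` (X1 `&` E) `<=` Y1 /\ completed_algebra_gen lam (psi @` (X1 `&` E)).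
Proof.
case: iso => nX1 _ [funp injp surp] iso_meas _ mE.
have sub : psi @` (X1 `&` E) `<=` Y1.
  by move=> _ [x [Xx _] <-]; exact: funp.
split => //; apply/(iso_meas _ sub).
have -> : X1 `&` psi @^-1` (psi @` (X1 `&` E)) = X1 `&` E.
  apply/seteqP; split => x /=.
    move=> [Xx [y [Xy Ey] yx]]; split => //.
    by rewrite -(injp y x _ _ yx)// inE.
  by move=> [Xx Ex]; split => //; exists x.
apply: completed_mod0 mE _ _.
  by apply: negligibleS nX1 => x [Ex nx] Xx; apply: nx.
by apply: negligibleS (negligible_set0 _) => x [[_ Ex] /(_ Ex)].
Qed.

(** If [C] is a closed set inside [G] and [V] an open set around [G] within the unit interval, then
    there membership in [G] and in [V] agree off [V] minus [C]. Removing these differences for all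
    [i] leaves a compact set, at a summable cost. *)
Lemma lusin_compact (D : set R) (G : nat -> set R) (eps : R) : (0 < eps)%R ->
  completed_algebra_gen lam D -> (forall i, completed_algebra_gen lam (G i)) ->
  exists K W : set R, [/\ compact K, K `<=` D,
    forall i, exists2 V : set R, open V &
      forall t, K t -> (V t <-> G i t),
    measurable W /\ lebesgue_measure W <= eps%:E &
    D `&` `[0%R, 1%R] `\` K `<=` W].
Proof.
move=> e0 cD cG.
(* [D] gets index 0, so that one sequence of approximations handles the domain together with all
   [G i]. *)
pose H i := if i is j.+1 then G j else D.
have cH i : completed_algebra_gen lam (H i) by case: i.
have ei i : (0 < eps / (2 ^ i.+1)%:R)%R.
  by rewrite divr_gt0// ltr0n expn_gt0.
have /choice[CV CVP] (i : nat) : exists CV : set R * set R,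
    [/\ compact CV.1, open CV.2, CV.1 `<=` H i `&` `[0%R, 1%R],
    H i `&` `[0%R, 1%R] `<=` CV.2 &
    lebesgue_measure (CV.2 `\` CV.1) < (eps / (2 ^ i.+1)%:R)%:E].
  have [C [V CV]] := completed_lebesgue_regular (ei i) (cH i).
  by exists (C, V).
have clC i : closed (CV i).1.
  by case: (CVP i) => cC _ _ _ _; apply: compact_closed.
pose K := (CV 0%N).1 `&` \bigcap_i ((CV i).1 `|` ~` (CV i).2).
pose W := \bigcup_i ((CV i).2 `\` (CV i).1).
have mW i : measurable ((CV i).2 `\` (CV i).1 : set R).
  by case: (CVP i) => cC oV _ _ _; apply: measurableD;
    [exact: open_measurable|exact: compact_measurable].
exists K, W; split.
- case: (CVP 0%N) => cC _ _ _ _; apply: subclosed_compact cC _.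
    apply: closedI; first exact: clC.
    apply: closed_bigI => i _; apply: closedU; first exact: clC.
    by apply: open_closedC; case: (CVP i).
  exact: subIsetl.
- by move=> t [C0t _]; case: (CVP 0%N) => _ _ /(_ _ C0t)[].
- move=> i; exists (CV i.+1).2; first by case: (CVP i.+1).
  move=> t [C0t /(_ i.+1 I) Kt]; split.
    by case: Kt => // Ct _; case: (CVP i.+1) => _ _ /(_ _ Ct)[].
  move=> Gt; case: (CVP i.+1) => _ _ _ + _; apply; split => //.
  by case: (CVP 0%N) => _ _ /(_ _ C0t)[].
- split; first exact: bigcupT_measurable.
  have mU : measurable W by exact: bigcupT_measurable.
  have h := measure_sigma_subadditive (@lebesgue_measure R) mW mU (@subset_refl _ _).
  apply: le_trans h _.
  apply: le_trans (epsilon_trick0 xpredT (ltW e0)).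
  apply: lee_nneseries => // i _.
  by case: (CVP i) => _ _ _ _ /ltW.
- move=> t [Dt nKt]; apply: contrapT => nWt; apply: nKt; split.
    apply: contrapT => nC; apply: nWt; exists 0%N => //; split => //.
    by case: (CVP 0%N) => _ _ _ + _; apply.
  move=> i _; apply: contrapT => /not_orP[nC /contrapT V].
  by apply: nWt; exists i.
Qed.

(* Lusin's theorem makes [Phi \o psi^-1] continuous on compact sets that exhaust
   [psi @` E] up to a null set; their images are compact, hence Borel. *)
Lemma image_inner_measurable (Z : ptopologicalType) (O : nat -> set Z)
    (Phi : X -> Z) (E : set X) :
  hausdorff_space Z -> (forall i, open (O i)) ->
  (forall (z : Z) U, open U -> U z -> exists i, O i z /\ O i `<=` U) ->
  (forall i, measurable (Phi @^-1` O i)) -> measurable E ->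
  exists V : set (g_sigma_algebraType (@open Z)),
    [/\ measurable V, V `<=` Phi @` E & mu.-negligible (E `\` Phi @^-1` V)].
Proof.
move=> hZ oO basO mO mE.
have [nX1 nY1 [funp injp surp] iso_meas iso_mu] := iso.
have [DY cD] := coordinate_completed mE.
have cG i := (coordinate_completed (mO i)).2.
pose e (n : nat) : R := (n.+1%:R^-1)%R.
have e0 n : (0 < e n)%R by rewrite invr_gt0.
have /choice[KW KWP] n : exists KW : set R * set R, [/\ compact KW.1,
    KW.1 `<=` psi @` (X1 `&` E),
    forall i, exists2 V : set R, open V &
      forall t, KW.1 t -> (V t <-> (psi @` (X1 `&` Phi @^-1` O i)) t),
    measurable KW.2 /\ lebesgue_measure KW.2 <= (e n)%:E &
    psi @` (X1 `&` E) `&` `[0%R, 1%R] `\` KW.1 `<=` KW.2].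
  have [K [W KW]] := lusin_compact (e0 n) cD cG.
  by exists (K, W).
pose Psi t : Z := xget point [set z | exists x, [/\ X1 x, psi x = t & Phi x = z]].
have PsiE x : X1 x -> Psi (psi x) = Phi x.
  move=> Xx; apply: xget_unique; first by exists x.
  by move=> _ [y [Xy yx <-]]; rewrite (injp y x _ _ yx)// inE.
have cPsi n : compact (Psi @` (KW n).1).
  have [cK KD KO _ _] := KWP n.
  apply: continuous_compact => //; apply/subspace_continuousP => t Kt.
  move=> U /=; rewrite nbhsE => -[B [oB Bt] BU].
  have [i [Ot OB]] := basO _ _ oB Bt.
  have [V oV VG] := KO i.
  have [x [Xx Ex] xt] := KD _ Kt.
  have Vt : V t.
    by apply/(VG _ Kt); exists x => //; split => //=; rewrite -PsiE// xt.
  change (nbhs t [set s | (KW n).1 s -> U (Psi s)]).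
  apply: filterS (open_nbhs_nbhs (conj oV Vt)) => s Vs Ks; apply: BU; apply: OB.
  have [y [Xy Oy] <-] := (VG _ Ks).1 Vs.
  by rewrite PsiE.
have KU n t : (KW n).1 t -> exists x, [/\ X1 x, E x & psi x = t].
  by have [_ KD _ _ _] := KWP n => /KD[x [Xx Ex] xt]; exists x.
exists (\bigcup_n Psi @` (KW n).1); split.
- apply: bigcupT_measurable => n.
  rewrite -(setCK (Psi @` _)); apply: measurableC; apply: sub_sigma_algebra.
  by apply: closed_openC; exact: (compact_closed hZ (cPsi n)).
- move=> _ [n _ [t /KU[x [Xx Ex <-]] <-]]; exists x => //.
  by rewrite PsiE.
- pose N := psi @` (X1 `&` E) `\` \bigcup_n (KW n).1.
  have nN : mu.-negligible (X1 `&` psi @^-1` N).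
    apply: coordinate_negligible; first by move=> t [/DY].
    (* [lam] does not charge the complement of the unit interval, and inside it a missed point lies
       in every [(KW n).2], of measure at most [e n]. *)
    pose M := ~` (`[0%R, 1%R]%classic : set R) `|` \bigcap_n (KW n).2.
    have mcap : measurable (\bigcap_n (KW n).2).
      by apply: bigcapT_measurable => n; case: (KWP n) => _ _ _ [].
    have mM : measurable M.
      by apply: measurableU => //; apply: measurableC.
    exists M; split => //.
    + suff h : lebesgue_measure (M `&` `[0%R, 1%R]) <= 0.
        by apply/eqP; rewrite eq_le measure_ge0 andbT; exact: h.
      apply/lee_addgt0Pr => r r0; rewrite add0e.
      have [n nr] : exists n, (e n < r)%R.
        have [n _ /(_ n (leqnn n)) H] := near_infty_natSinv_lt (PosNum r0).
        by exists n.
      apply: le_trans (_ : (e n)%:E <= _); last by rewrite lee_fin ltW.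
      case: (KWP n) => _ _ _ [mW We] _; apply: le_trans We.
      apply: le_measure; rewrite ?inE//; first exact: measurableI.
      by move=> t [[nI //|Wt] _]; exact: Wt.
    + move=> t [Dt nK]; have [It|nIt] := pselect (`[0%R, 1%R]%classic t).
        right => n _; case: (KWP n) => _ _ _ _; apply; split => // Kt.
        by apply: nK; exists n.
      by left.
  apply: (negligibleS (A := ~` X1 `|` (X1 `&` psi @^-1` N))); last first.
    exact: negligibleU.
  move=> x [Ex nV]; have [Xx|] := pselect (X1 x); last by left.
  right; split => //; split; first by exists x.
  move=> [n _ Kn]; apply: nV; exists n => //; exists (psi x) => //.
  exact: PsiE.
Qed.

(** Preimages of rational intervals under the coordinate do it. Each is measurable only up to a null
    set, so it is replaced by a measurable subset, and [X2] omits the countably many differences. *)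
Lemma coordinate_small_sets : exists (A : nat -> set X) (X2 : set X),
  [/\ forall k, measurable (A k), mu.-negligible (~` X2) &
    forall (x : X) (y : nat -> X) (n : nat) (eps : R), (0 < eps)%R -> X2 x ->
      (forall i, (i < n)%N -> X2 (y i) /\ y i <> x) ->
      exists k, [/\ A k x, forall i, (i < n)%N -> ~ A k (y i) &
        mu (A k) <= eps%:E]].
Proof.
have [nX1 nY1 [funp injp surp] iso_meas iso_mu] := iso.
pose J (q : rat * rat) : set R := `]ratr q.1, ratr q.2[%classic.
have JY q : J q `&` Y1 `<=` Y1 by exact: subIsetr.
have cJ q : completed_algebra_gen lam (J q `&` Y1).
  have mJ : measurable (J q) by exact: measurable_itv.
  apply: (@completed_mod0 _ _ _ lam _ _ mJ).
    by apply: negligibleS nY1 => t [Jt nJY] Yt; apply: nJY.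
  by apply: negligibleS (negligible_set0 _) => x [[Jx _] /(_ Jx)].
pose E q := X1 `&` psi @^-1` (J q `&` Y1).
have /choice[B BP] q : exists B, [/\ measurable B, B `<=` E q &
    mu.-negligible (E q `\` B)].
  by apply: completed_inner; apply/(iso_meas _ (JY q)).
have muB q : mu (B q) <= (ratr q.2 - ratr q.1 : R)%:E \/ B q = set0.
  have [q21|q12] := leP (ratr q.2 : R) (ratr q.1).
    right; apply/seteqP; split => // x; case: (BP q) => _ + _ => /[apply].
    move=> -[_ [+ _]]; rewrite /J/= in_itv/= => /andP[l r].
    by have := lt_trans l r; rewrite ltNge q21.
  left; case: (BP q) => mB BE nEB.
  rewrite -(mu_ext_mod0 mB BE nEB) (iso_mu _ (JY q) (cJ q)).
  have mJ : measurable (J q) by exact: measurable_itv.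
  apply: (@mu_ext_le_measurable _ (measurableTypeR R) R lam (J q)).
  - exact: mJ.
  - exact: subIsetl.
  apply: le_trans (_ : lebesgue_measure (J q) <= _).
    by apply: le_measure; rewrite ?inE//; exact: measurableI.
  by rewrite lebesgue_measure_itv/= lte_fin q12.
pose A k := if unpickle k is Some q then B q else set0.
exists A, (X1 `\` \bigcup_k (if unpickle k is Some q then E q `\` B q else set0)).
split.
- by move=> k; rewrite /A; case: unpickle => // q; case: (BP q).
- rewrite setCD; apply: negligibleU => //; apply: negligible_bigcup => k.
  by case: unpickle => [q|]; [case: (BP q)|exact: negligible_set0].
- move=> x y n eps e0 [Xx nx] yP.
  have [r r0 rP] : exists2 r : R, (0 < r)%R &
      forall i, (i < n)%N -> (r <= `|psi (y i) - psi x|)%R.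
    elim: n yP => [|n IHn] yP; first by exists 1%R.
    have [i /ltnW ni|r r0 rP] := IHn; first exact: yP.
    have [[Xy _] yx] := yP n (leqnn _).
    exists (Num.min r `|psi (y n) - psi x|)%R.
      rewrite lt_min r0 normr_gt0 subr_eq0; apply/eqP => /injp yxE.
      by apply: yx; apply: yxE; rewrite inE.
    move=> i; rewrite ltnS leq_eqVlt => /orP[/eqP->|lti].
      by rewrite ge_min lexx orbT.
    by rewrite ge_min rP.
  (* The interval to be found lies within [s] of [psi x]: the bound [r] keeps the other points out,
     and [eps / 2] makes its length at most [eps]. *)
  pose s : R := (Num.min r (eps / 2))%R.
  have s0 : (0 < s)%R by rewrite lt_min r0 divr_gt0.
  have [a] : exists q, ratr q \in `](psi x - s)%R, psi x[.
    by apply: rat_in_itvoo; rewrite ltrBlDr ltrDl.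
  rewrite in_itv/= => /andP[a1 a2].
  have [b] : exists q, ratr q \in `]psi x, (psi x + s)%R[.
    by apply: rat_in_itvoo; rewrite ltrDl.
  rewrite in_itv/= => /andP[b1 b2].
  have sub z : X1 z -> J (a, b) (psi z) -> E (a, b) z.
    by move=> Xz Jz; split => //; split => //; exact: funp.
  have [k kE] : exists k, unpickle k = Some (a, b).
    by exists (pickle (a, b)); exact: pickleK.
  exists k; rewrite /A kE; split.
  + have Exab : E (a, b) x by apply: sub => //; rewrite /J/= in_itv/= a2 b1.
    apply: contrapT => nBx; apply: nx; exists k; first by [].
    by rewrite kE.
  + move=> i ni; case: (BP (a, b)) => _ + _ => /[apply] -[_ [+ _]].
    rewrite /J/= in_itv/= => /andP[l1 l2].
    have := rP i ni; apply/negP; rewrite -ltNge.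
    apply: lt_le_trans (_ : s <= r)%R; last by rewrite ge_min lexx.
    rewrite ltr_norml; apply/andP; split.
      by rewrite ltrBrDr addrC; apply: lt_trans l1.
    by rewrite ltrBlDl; apply: lt_trans l2 _.
  + case: (muB (a, b)) => [|->]; last by rewrite measure0 lee_fin ltW.
    move/le_trans; apply; rewrite lee_fin /=.
    have se : (s <= eps / 2)%R by rewrite ge_min lexx orbT.
    lra.
Qed.

End coordinates.

(** * Injective measurable maps on standard spaces *)

Section standard_spaces.
Context d (X : measurableType d) (R : realType) (mu : probability X R).
Hypothesis stdX : standard_lebesgue mu.
Variables (Z : ptopologicalType) (O : nat -> set Z).
Hypothesis hZ : hausdorff_space Z.
Hypothesis oO : forall i, open (O i).
Hypothesis basO : forall (z : Z) U, open U -> U z ->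
  exists i, O i z /\ O i `<=` U.
Local Notation BZ := (g_sigma_algebraType (@open Z)).
Variable Phi : X -> BZ.
Hypothesis mPhi : measurable_fun setT Phi.
Local Open Scope ereal_scope.

Lemma measurable_preimage (V : set BZ) : measurable V -> measurable (Phi @^-1` V).
Proof. by move=> mV; rewrite -[X in measurable X]setTI; exact: mPhi. Qed.

Lemma image_inner (E : set X) : completed_algebra_gen mu E ->
  exists V : set BZ,
    [/\ measurable V, V `<=` Phi @` E & mu.-negligible (E `\` Phi @^-1` V)].
Proof.
move=> /completed_inner[A [mA AE nEA]].
have [X1 [Y1 [psi iso]]] := stdX.
have mO i : measurable (Phi @^-1` O i).
  by apply: measurable_preimage; exact: sub_sigma_algebra.
have [V [mV VA nAV]] := image_inner_measurable iso hZ oO basO mO mA.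
exists V; split => //.
  by move=> z /VA[x Ax <-]; exists x => //; exact: AE.
apply: (negligibleS (A := (E `\` A) `|` (A `\` Phi @^-1` V))); last first.
  exact: negligibleU.
by move=> x [Ex nV]; have [Ax|nAx] := pselect (A x); [right|left].
Qed.

Variable nu : probability BZ R.
Hypothesis nuE : forall B, measurable B -> nu B = mu (Phi @^-1` B).

Lemma pushforward_negligible (V : set BZ) : measurable V ->
  mu.-negligible (~` (Phi @^-1` V)) -> nu.-negligible (~` V).
Proof.
move=> mV nV; exists (~` V); split => //; first exact: measurableC.
rewrite nuE; last exact: measurableC.
by apply: measure_negligible => //; apply/measurableC/measurable_preimage.
Qed.

(** The delicate direction is that [B] is completed measurable as soon as its preimage is. Lusin's
    theorem supplies Borel sets [V] and [W] inside the images of the preimage and of its complement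
    in [X0]; one lies in [B], the other misses it, and their union is conull. *)
Lemma injective_mod0_isomorphism (X0 : set X) :
  mu.-negligible (~` X0) -> set_inj X0 Phi ->
  mod0_isomorphism mu nu X0 (Phi @` X0) Phi.
Proof.
move=> nX0 injPhi.
have cX0 : completed_algebra_gen mu X0.
  apply: (completed_mod0 (@measurableT _ X)); first by rewrite setTD.
  by rewrite setDT; exact: negligible_set0.
have inner B : B `<=` Phi @` X0 ->
    completed_algebra_gen mu (X0 `&` Phi @^-1` B) ->
    exists V, [/\ measurable V, V `<=` B & nu.-negligible (B `\` V)].
  move=> BX0 cE.
  have [V [mV VE nEV]] := image_inner cE.
  have cF : completed_algebra_gen mu (X0 `\` Phi @^-1` B).
    have [A [mA AE nEA]] := completed_inner cE.
    apply: (completed_mod0 (measurableC mA)).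
      apply: (negligibleS (A := (X0 `&` Phi @^-1` B `\` A) `|` ~` X0)).
        move=> x [nAx nF]; have [Xx|//] := pselect (X0 x); last by right.
        left; split => //; split => //; apply: contrapT => nB.
        by apply: nF.
      exact: negligibleU.
    apply: negligibleS (negligible_set0 _) => x [[_ nBx] /contrapT/AE[_]].
    exact: nBx.
  have [W [mW WF nFW]] := image_inner cF.
  exists V; split => //; first by move=> z /VE[x [_ Bx] <-].
  apply: (negligibleS (A := ~` (V `|` W))).
    move=> z [Bz nVz] [//|/WF[x [_ nBx] xz]].
    by apply: nBx; rewrite /preimage/= xz.
  apply: pushforward_negligible; first exact: measurableU.
  apply: (negligibleS (A := ~` X0 `|` (((X0 `&` Phi @^-1` B) `\` Phi @^-1` V)
     `|` ((X0 `\` Phi @^-1` B) `\` Phi @^-1` W)))).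
    move=> x nVW; have [Xx|] := pselect (X0 x); last by left.
    right; have [Bx|nBx] := pselect ((Phi @^-1` B) x); [left|right].
      by split => // Vx; apply: nVW; left.
    by split => // Wx; apply: nVW; right.
  by apply: negligibleU => //; exact: negligibleU.
have outer B : B `<=` Phi @` X0 -> completed_algebra_gen nu B ->
    exists A, [/\ measurable A, A `<=` B &
      mu.-negligible (X0 `&` Phi @^-1` B `\` Phi @^-1` A) /\
      nu.-negligible (B `\` A)].
  move=> BX0 /completed_inner[A [mA AB [N [mN N0 BAN]]]].
  exists A; split => //; split; last by exists N.
  exists (Phi @^-1` N); split; first exact: measurable_preimage.
    by rewrite -nuE.
  by move=> x [[_ Bx] nAx]; apply: BAN.
have nI A : measurable A -> mu.-negligible (Phi @^-1` A `\` X0).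
  by move=> mA; apply: negligibleS nX0 => x [].
have mid B A : A `<=` B ->
    mu.-negligible (X0 `&` Phi @^-1` B `\` Phi @^-1` A) ->
    mu.-negligible (X0 `&` Phi @^-1` B `\` (X0 `&` Phi @^-1` A)).
  by move=> AB; apply: negligibleS => x [[Xx Bx] nA]; split => // Ax; apply: nA.
split => //.
- have [W [mW WX0 nW]] := image_inner cX0.
  apply: (negligibleS (A := ~` W)); first by move=> z nz /WX0.
  apply: pushforward_negligible => //.
  apply: (negligibleS (A := ~` X0 `|` (X0 `\` Phi @^-1` W))).
    by move=> x nWx; have [Xx|nXx] := pselect (X0 x); [right|left].
  exact: negligibleU.
- by split => // x Xx; exists x.
- move=> B BX0; split.
    move=> /(outer _ BX0)[A [mA AB [nmu _]]].
    apply: (completed_mod0 (measurable_preimage mA)).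
      apply: negligibleS (nI _ mA) => x [Ax nx]; split => // Xx.
      by apply: nx; split => //; exact: AB.
    exact: nmu.
  move=> /(inner _ BX0)[V [mV VB nBV]].
  apply: (completed_mod0 mV) => //.
  by apply: negligibleS (negligible_set0 _) => x [/VB].
- move=> B BX0 /(outer _ BX0)[A [mA AB [nmu nnu]]].
  rewrite [RHS](mu_ext_mod0 mA AB nnu); apply: etrans _ (esym (nuE mA)).
  have [N [mN N0 XN]] := nX0.
  have mE : measurable (Phi @^-1` A `\` N).
    by apply: measurableD => //; exact: measurable_preimage.
  rewrite (@mu_ext_mod0 _ _ _ _ (Phi @^-1` A `\` N))//.
  + apply/eqP; rewrite eq_le; apply/andP; split.
      apply: le_measure; rewrite ?inE//; exact: measurable_preimage.
    rewrite -[leRHS]adde0 -N0.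
    apply: le_trans (measureU2 _ mE mN).
    apply: le_measure; rewrite ?inE//; first exact: measurable_preimage.
      exact: measurableU.
    by move=> x Ax; have [Nx|nNx] := pselect (N x); [right|left].
  + move=> x [Ax nNx]; split; last exact: AB.
    by apply: contrapT => /XN.
  + apply: (negligibleS (A := (X0 `&` Phi @^-1` B `\` Phi @^-1` A) `|` N)).
      move=> x [[Xx Bx] nx].
      have [Nx|nNx] := pselect (N x); first by right.
      by left; split => // Ax; apply: nx.
    by apply: negligibleU => //; apply/negligibleP.
Qed.

End standard_spaces.

(** * Ergodic maps and sparse sets *)

Section dynamics.
Context d (X : measurableType d) (R : realType) (mu : probability X R).
Variable T : X -> X.
Local Open Scope ereal_scope.

Lemma probability_DI (A B : set X) : measurable A -> measurable B ->
  mu A = mu (A `\` B) + mu (A `&` B).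
Proof. exact: measureDI. Qed.

Lemma negligible_meet (S Y : set X) : measurable S -> 0 < mu S ->
  mu.-negligible (~` Y) -> exists x, S x /\ Y x.
Proof.
move=> mS S0 nY; apply: contrapT => nex; move: S0.
suff -> : mu S = 0 by rewrite ltxx.
apply: measure_negligible => //; apply: negligibleS nY => x Sx Yx.
by apply: nex; exists x.
Qed.

Hypothesis mpT : measure_preserving mu T.

Lemma measurable_preimage_iter n (B : set X) : measurable B ->
  measurable (iter n T @^-1` B).
Proof.
elim: n B => [//|n IHn] B mB.
have -> : iter n.+1 T @^-1` B = iter n T @^-1` (T @^-1` B) by [].
by apply: IHn; rewrite -[X in measurable X]setTI; exact: mpT.1.
Qed.

Lemma measure_preimage_iter n (B : set X) : measurable B ->
  mu (iter n T @^-1` B) = mu B.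
Proof.
elim: n B => [//|n IHn] B mB.
have -> : iter n.+1 T @^-1` B = iter n T @^-1` (T @^-1` B) by [].
rewrite IHn ?mpT.2//.
exact: (measurable_preimage_iter 1).
Qed.

Lemma negligible_preimage_iter n (N : set X) : mu.-negligible N ->
  mu.-negligible (iter n T @^-1` N).
Proof.
move=> [M [mM M0 NM]]; exists (iter n T @^-1` M); split.
- exact: measurable_preimage_iter.
- by rewrite measure_preimage_iter.
- by move=> x /NM.
Qed.

Lemma negligible_forward_core (Y : set X) : mu.-negligible (~` Y) ->
  mu.-negligible (~` [set x | forall n, Y (iter n T x)]).
Proof.
move=> nY; apply: (negligibleS (A := \bigcup_n iter n T @^-1` (~` Y))).
  by move=> x /= /existsNP[n nYx]; exists n.
by apply: negligible_bigcup => n; exact: negligible_preimage_iter.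
Qed.

Hypothesis ergT : ergodic mu T.

(** [ergodic] speaks of strictly invariant sets. The set [S] of points that visit [D] infinitely
    often is one, and it agrees with [D] up to a null set: [D] lies almost inside each [T^-n D],
    which has the same measure, hence almost equals it. *)
Lemma ergodic_subinvariant (D : set X) : measurable D ->
  mu.-negligible (D `\` T @^-1` D) -> mu D = 0 \/ mu D = 1.
Proof.
move=> mD nD.
pose S : set X := \bigcap_m \bigcup_n iter (m + n) T @^-1` D.
have mS : measurable S.
  apply: bigcapT_measurable => m; apply: bigcupT_measurable => n.
  exact: measurable_preimage_iter.
have TS : T @^-1` S = S.
  apply/seteqP; split => x Sx m _.
    have [n _ /= Dn] := Sx m I; exists n.+1 => //=.
    by rewrite addnS iterSr.
  have [n _ /= Dn] := Sx m.+1 I; exists n => //=.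
  by rewrite -iterSr.
have nDn n : mu.-negligible (D `\` iter n T @^-1` D).
  elim: n => [|n IHn].
    by apply: negligibleS (negligible_set0 _) => x [Dx /(_ Dx)].
  apply: (negligibleS (A := (D `\` T @^-1` D) `|`
      iter 1 T @^-1` (D `\` iter n T @^-1` D))); last first.
    by apply: negligibleU => //; exact: negligible_preimage_iter.
  move=> x [Dx nDx]; have [DTx|nDTx] := pselect ((T @^-1` D) x); last by left.
  by right; split => //= DnTx; apply: nDx; rewrite /= -iterS iterSr.
have nnD n : mu.-negligible (iter n T @^-1` D `\` D).
  have mn := measurable_preimage_iter n mD.
  apply/negligibleP; first exact: measurableD.
  have mI : measurable (D `&` iter n T @^-1` D) by exact: measurableI.
  have d0 : mu (D `\` iter n T @^-1` D) = 0.
    by apply: measure_negligible => //; exact: measurableD.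
  have e1 := probability_DI mD mn; rewrite d0 add0e in e1.
  have e2 := probability_DI mn mD.
  rewrite measure_preimage_iter// setIC -e1 in e2.
  by rewrite -[LHS](addeK _ (fin_num_measure mu _ mD)) -e2 subee// fin_num_measure.
have DS : mu (D `\` S) = 0.
  apply: measure_negligible; first exact: measurableD.
  apply: (negligibleS (A := \bigcup_n (D `\` iter n T @^-1` D))); last first.
    exact: negligible_bigcup.
  move=> x [Dx nSx]; apply: contrapT => nU; apply: nSx => m _.
  exists 0%N => //=; rewrite addn0; apply: contrapT => nDx.
  by apply: nU; exists m.
have SD : mu (S `\` D) = 0.
  apply: measure_negligible; first exact: measurableD.
  apply: (negligibleS (A := \bigcup_n (iter n T @^-1` D `\` D))); last first.
    exact: negligible_bigcup.
  by move=> x [/(_ 0%N I)[n _ /= Dn] nDx]; exists n.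
have -> : mu D = mu S.
  have e1 := probability_DI mD mS; have e2 := probability_DI mS mD.
  by rewrite e1 e2 DS SD setIC.
exact: ergT.2.
Qed.

(** If almost every point of [C] returned within [m] steps, the union [D] of its preimages of orders
    0 to [m - 1] would be subinvariant, hence of measure 0 or 1; but it contains [C] and has measure
    at most [m * eps]. *)
Lemma ergodic_no_quick_return (C : set X) (m : nat) (eps : R) : measurable C ->
  0 < mu C -> mu C <= eps%:E -> (m%:R * eps < 1)%R ->
  0 < mu (C `\` \bigcup_(i in `I_m) iter i.+1 T @^-1` C).
Proof.
move=> mC C0 Ce me.
pose D := \bigcup_(i in `I_m) iter i T @^-1` C.
have mD : measurable D.
  by apply: bigcup_measurable => i _; exact: measurable_preimage_iter.
have TD : T @^-1` D = \bigcup_(i in `I_m) iter i.+1 T @^-1` C.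
  by apply/seteqP; split => x [i im /= Ci]; exists i => //=;
    move: Ci; rewrite /= -iterS iterSr.
rewrite -TD lt0e measure_ge0 andbT; apply/eqP => nu0.
have mTD : measurable (T @^-1` D) by exact: (measurable_preimage_iter 1).
have nD : mu.-negligible (D `\` T @^-1` D).
  apply: (negligibleS (A := C `\` T @^-1` D)); last first.
    by apply/negligibleP => //; exact: measurableD.
  move=> x [[[|i] /= im Ci] nx]; first by split.
  case: nx; exists i => /=; first exact: ltnW.
  by move: Ci; rewrite /= -iterS iterSr.
(* For [m = 0] the set [D] is empty and does not contain [C]. *)
case: m me @D mD TD nu0 mTD nD => [|m] me D mD TD nu0 mTD nD.
  move: nu0; have -> : C `\` T @^-1` D = C.
    by apply/seteqP; split => x; [case|move=> Cx; split => // -[]].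
  by move=> nu0; rewrite nu0 ltxx in C0.
have CD : mu C <= mu D.
  by apply: le_measure; rewrite ?inE// => x Cx; exists 0%N.
have D1 : mu D < 1.
  apply: le_lt_trans (_ : (m.+1%:R * eps)%:E < _); last by rewrite lte_fin.
  rewrite /D bigcup_mkord.
  have mi i : (i < m.+1)%N -> measurable (iter i T @^-1` C).
    by move=> _; exact: measurable_preimage_iter.
  apply: (le_trans (Boole_inequality mu mi)).
  apply: (@le_trans _ _ (\sum_(i < m.+1) eps%:E)).
    have mui i : mu (iter i T @^-1` C) <= eps%:E by rewrite measure_preimage_iter.
    by apply: lee_sum => i _; exact: mui.
  by rewrite sumEFin lee_fin sumr_const card_ord mulr_natl.
case: (ergodic_subinvariant mD nD) => D01.
  by move: C0; rewrite ltNge -D01 CD.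
by rewrite D01 ltxx in D1.
Qed.

Hypothesis stdX : standard_lebesgue mu.

(** [B k] keeps the points of [A k] that do not come back within [N] steps. A typical point without
    a period up to [N] lies in some [B k], since some [A k] around it avoids its next [N] iterates.
    That almost all points have no such period follows from ergodicity and the abundance of small
    sets. *)
Lemma sparse_family (N : nat) : exists (B : nat -> set X) (Y : set X),
  [/\ forall k, measurable (B k),
    forall k x i, (i < N)%N -> B k x -> ~ B k (iter i.+1 T x),
    mu.-negligible (~` Y) &
    forall x y (eps : R), (0 < eps)%R -> Y x -> Y y ->
      exists k, [/\ B k x, y <> x -> ~ B k y & mu (B k) <= eps%:E]].
Proof.
have [X1 [Y1 [psi iso]]] := stdX.
have [A [X2 [mA nX2 AP]]] := coordinate_small_sets iso.
pose B k := A k `\` \bigcup_(i in `I_N) iter i.+1 T @^-1` A k.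
have mB k : measurable (B k).
  apply: measurableD => //; apply: bigcup_measurable => i _.
  exact: measurable_preimage_iter.
pose X3 := [set x | forall n, X2 (iter n T x)].
have nX3 : mu.-negligible (~` X3) by exact: negligible_forward_core.
pose Y := [set x | X3 x /\ forall i, (i < N)%N -> iter i.+1 T x <> x].
pose V := \bigcup_k B k.
have mV : measurable V by exact: bigcupT_measurable.
have in_B x k : A k x -> (forall i, (i < N)%N -> ~ A k (iter i.+1 T x)) -> B k x.
  by move=> Ax nAx; split => // -[i /= iN]; exact: nAx.
have muBA k : mu (B k) <= mu (A k).
  by apply: le_measure; rewrite ?inE//; exact: subIsetl.
exists B, Y; split => //.
- by move=> k x i iN [Ax nx] [Aix _]; apply: nx; exists i.
(* Points of [V] have no period up to [N], so it is enough that [V] is conull. *)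
- suff V0 : mu (~` V) = 0.
    apply: (negligibleS (A := ~` X3 `|` ~` V)); last first.
      by apply: negligibleU => //; apply/negligibleP => //; exact: measurableC.
    move=> x nYx; have [X3x|] := pselect (X3 x); last by left.
    right => -[k _ [Ax nx]]; apply: nYx; split => // i iN Tx.
    have Axi : A k (iter i.+1 T x) by rewrite Tx.
    by apply: nx; exists i.
  apply: contrapT => /eqP V0.
  have mVC : measurable (~` V) by exact: measurableC.
  have {}V0 : 0 < mu (~` V) by rewrite lt0e V0 measure_ge0.
  pose eps : R := (N.+1%:R^-1 / 2)%R.
  have eps0 : (0 < eps)%R by rewrite divr_gt0// invr_gt0.
  have Neps : (N%:R * eps < 1)%R.
    rewrite /eps mulrA ltr_pdivrMr// mul1r.
    apply: (@lt_trans _ _ 1%R); last by rewrite ltr1n.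
    by rewrite ltr_pdivrMr// mul1r ltr_nat.
  pose A' k := if mu (A k) <= eps%:E then A k else set0.
  have mA' k : measurable (~` V `&` A' k).
    by apply: measurableI => //; rewrite /A'; case: ifP.
  have [k Ck] : exists k, 0 < mu (~` V `&` A' k).
    apply: contrapT => /forallNP nk; move: V0.
    suff -> : mu (~` V) = 0 by rewrite ltxx.
    apply: measure_negligible => //.
    apply: (negligibleS (A := ~` X2 `|` \bigcup_k (~` V `&` A' k))).
      move=> x nVx; have [X2x|] := pselect (X2 x); last by left.
      right; have [//|k [Ak _ muk]] := AP x (fun=> x) 0%N eps eps0 X2x.
      by exists k => //; split => //; rewrite /A' muk.
    apply: negligibleU => //; apply: negligible_bigcup => k.
    apply/negligibleP => //; apply/eqP; rewrite eq_le measure_ge0 andbT.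
    by have /negP := nk k; rewrite -leNgt.
  pose C := ~` V `&` A' k.
  have Ceps : mu C <= eps%:E.
    apply: (@le_trans _ _ (mu (A' k))).
      apply: le_measure; [by rewrite inE; exact: mA'| |exact: subIsetr].
      by rewrite inE /A'; case: ifP.
    by rewrite /A'; case: ifP => //; rewrite measure0 lee_fin (ltW eps0).
  (* [C] is too small for all its points to return quickly. A point that does not return to [C] has
     no period up to [N], hence lies in some [B k'], although [C] was chosen outside all of
     these. *)
  have C'0 := ergodic_no_quick_return (mA' k) Ck Ceps Neps.
  have [|x [[Cx nCx] X3x]] := negligible_meet _ C'0 nX3.
    apply: measurableD => //; apply: bigcup_measurable => i _.
    exact: measurable_preimage_iter.
  case: (Cx) => nVx A'x; apply: nVx.
  have [||k' [Ak' nAk' _]] := AP x (fun i => iter i.+1 T x) N eps eps0.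
  + exact: (X3x 0%N).
  + move=> i iN; split; first exact: X3x.
    move=> Tx; have Ci : (~` V `&` A' k) (iter i.+1 T x) by rewrite Tx.
    by apply: nCx; exists i.
  + by exists k' => //; exact: in_B.
- move=> x y eps eps0 [X3x Tx] [X3y _].
  pose s i := if (i < N)%N then iter i.+1 T x else y.
  pose n := if pselect (y = x) then N else N.+1.
  have Nn : (N <= n)%N by rewrite /n; case: pselect => ?.
  have nN : y <> x -> n = N.+1 by rewrite /n; case: pselect => ?.
  have [||k [Ak nAk muk]] := AP x s n eps eps0.
  + exact: (X3x 0%N).
  + move=> i; rewrite /n /s; case: pselect => [yx|nyx].
      by move=> iN; rewrite iN; split; [exact: X3x|exact: Tx].
    rewrite ltnS leq_eqVlt => /orP[/eqP ->|iN].
      by rewrite ltnn; split => //; exact: (X3y 0%N).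
    by rewrite iN; split; [exact: X3x|exact: Tx].
  + exists k; split.
    * apply: in_B => // i iN.
      have -> : iter i.+1 T x = s i by rewrite /s iN.
      by apply: nAk; exact: leq_trans iN Nn.
    * move=> nyx [Aky _]; apply: (nAk N); last by rewrite /s ltnn.
      by rewrite nN.
    * exact: le_trans muk.
Qed.

End dynamics.

(** * Real-valued norms and limits *)

(* [ofR] stands for the identity of [R] or for the embedding of [R] into [R[i]];
   [rnorm] is the norm with its values read back in [R]. *)
Definition real_embedding (R : realType) (K : numFieldType)
    (ofR : {rmorphism R -> K}) : Prop :=
  (forall x y, (ofR x <= ofR y) = (x <= y)) /\
  (forall k : K, 0 <= k -> exists r, ofR r = k).

Definition rnorm (R : realType) (K : numFieldType) (ofR : {rmorphism R -> K})
    (V : normedZmodType K) (x : V) : R :=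
  xget 0 [set r | ofR r = `|x|].

Section real_norm.
Context (R : realType) (K : numFieldType) (ofR : {rmorphism R -> K}).
Hypothesis ofRP : real_embedding ofR.

Lemma ofR_lt x y : (ofR x < ofR y) = (x < y).
Proof. by rewrite !lt_neqAle ofRP.1 (inj_eq (fmorph_inj ofR)). Qed.

Lemma ofR_gt0 (e : K) : 0 < e -> exists2 r : R, 0 < r & ofR r = e.
Proof.
move=> e0; have [r re] := ofRP.2 _ (ltW e0); exists r => //.
by rewrite -ofR_lt rmorph0 re.
Qed.

Section normed_group.
Context (V : normedZmodType K).
Implicit Types x y : V.
Local Notation "`[ x ]" := (rnorm ofR x) (format "`[ x ]").

Lemma rnormE x : ofR `[x] = `|x|.
Proof.
rewrite /rnorm; case: xgetP => // h.
by have [r /h] := ofRP.2 _ (normr_ge0 x).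
Qed.

Lemma rnorm_ge0 x : 0 <= `[x].
Proof. by rewrite -ofRP.1 rmorph0 rnormE. Qed.

Lemma rnorm0 : `[0 : V] = 0.
Proof. by apply: (fmorph_inj ofR); rewrite rnormE normr0 rmorph0. Qed.

Lemma rnorm_eq0 x : `[x] = 0 -> x = 0.
Proof. by move=> x0; apply/normr0_eq0; rewrite -rnormE x0 rmorph0. Qed.

Lemma rnormN x : `[- x] = `[x].
Proof. by apply: (fmorph_inj ofR); rewrite !rnormE normrN. Qed.

Lemma rnormBC x y : `[x - y] = `[y - x].
Proof. by rewrite -rnormN opprB. Qed.

Lemma rnormD x y : `[x + y] <= `[x] + `[y].
Proof. by rewrite -ofRP.1 rmorphD !rnormE ler_normD. Qed.

Lemma rnormB x y : `[x - y] <= `[x] + `[y].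
Proof. by rewrite -(rnormN y) rnormD. Qed.

Lemma rnorm_tri x y z : `[x - z] <= `[x - y] + `[y - z].
Proof. by rewrite -[x - z](subrKA y) rnormD. Qed.

Lemma rnorm_sum (I : Type) (r : seq I) (P : pred I) (F : I -> V) :
  `[\sum_(i <- r | P i) F i] <= \sum_(i <- r | P i) `[F i].
Proof.
elim/big_rec2: _ => [|i a b _ ab]; first by rewrite rnorm0.
by apply: le_trans (rnormD _ _) _; rewrite lerD2l.
Qed.

End normed_group.

Lemma rnormZ (V : normedModType K) (a : K) (x : V) :
  rnorm ofR (a *: x) = rnorm ofR a * rnorm ofR x.
Proof. by apply: (fmorph_inj ofR); rewrite rmorphM !rnormE normrZ. Qed.

Lemma rnorm_ofR (r : R) : 0 <= r -> rnorm ofR (ofR r) = r.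
Proof.
move=> r0; apply: (fmorph_inj ofR); rewrite rnormE ger0_norm//.
by rewrite -(rmorph0 ofR) ofRP.1.
Qed.

Lemma rnorm_gt0 (V : normedZmodType K) (x : V) : x != 0 -> 0 < rnorm ofR x.
Proof.
move=> x0; rewrite lt_neqAle rnorm_ge0 andbT eq_sym.
by apply: contra_neq x0; exact: rnorm_eq0.
Qed.

Context (Z : completeNormedModType K).
Local Notation "`[ x ]" := (rnorm ofR x) (format "`[ x ]").

Lemma rnorm_nbhs (x : Z) (U : set Z) :
  nbhs x U <-> exists2 r : R, 0 < r & forall y, `[y - x] < r -> U y.
Proof.
split=> [/nbhs_normP[e /= e0 eU]|[r r0 rU]].
  have [r r0 re] := ofR_gt0 e0; exists r => // y yx; apply: eU => /=.
  by rewrite -re -rnormE ofR_lt rnormBC.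
apply/nbhs_normP; exists (ofR r) => /=; first by rewrite -(rmorph0 ofR) ofR_lt.
by move=> y /=; rewrite -rnormE ofR_lt rnormBC; exact: rU.
Qed.

Lemma rnorm_open (U : set Z) :
  open U <-> forall x, U x -> exists2 r : R, 0 < r & forall y, `[y - x] < r -> U y.
Proof.
by rewrite openE; split => H x Ux; apply/rnorm_nbhs; exact: H.
Qed.

Lemma rnorm_ball_open (x : Z) (r : R) : open [set y | `[y - x] < r].
Proof.
apply/rnorm_open => y /= yx; exists (r - `[y - x]); first by rewrite subr_gt0.
by move=> z; rewrite ltrBrDr; apply: le_lt_trans; exact: rnorm_tri.
Qed.

Definition rlim (u : nat -> Z) (l : Z) : Prop :=
  forall e : R, 0 < e -> exists n, forall m, (n <= m)%N -> `[u m - l] <= e.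

Lemma rlim_complete (u : nat -> Z) :
  (forall e : R, 0 < e -> exists n, forall m, (n <= m)%N -> `[u m - u n] <= e) ->
  exists l, rlim u l.
Proof.
move=> cu.
have : cauchy (u @ \oo).
  apply: cauchy_exP => e /ofR_gt0[r r0 re].
  have [n nP] := cu (r / 2) (divr_gt0 r0 (ltr0n _ 2)).
  exists (u n); exists n => // m /nP mn.
  rewrite -ball_normE /=/ball_/= -re -rnormE ofR_lt rnormBC.
  by apply: le_lt_trans mn _; rewrite ltr_pdivrMr// ltr_pMr// ltr1n.
move=> /cauchy_cvg/cvg_ex[l ul]; exists l => e e0.
have : nbhs l [set y | `[y - l] < e] by apply/rnorm_nbhs; exists e.
by move=> /ul[n _ nP]; exists n => m /nP/= /ltW.
Qed.

Lemma rlim_cvgn (u : nat -> Z) (l : Z) : u @ \oo --> l -> rlim u l.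
Proof.
move=> ul e e0.
have : nbhs l [set y | `[y - l] < e] by apply/rnorm_nbhs; exists e.
by move=> /ul[n _ nP]; exists n => m /nP/= /ltW.
Qed.

(* Stated as a closedness property so that it yields both bounds on limits and
   their uniqueness. *)
Lemma rlim_le (u : nat -> Z) (l c : Z) (n : nat) (b : R) : rlim u l ->
  (forall m, (n <= m)%N -> `[u m - c] <= b) -> `[l - c] <= b.
Proof.
move=> ul uc; apply/ler_addgt0Pr => e e0; have [m mP] := ul _ e0.
apply: le_trans (rnorm_tri _ (u (maxn n m)) _) _.
rewrite addrC; apply: lerD; first by apply: uc; rewrite leq_maxl.
by rewrite rnormBC; apply: mP; rewrite leq_maxr.
Qed.

Lemma rlim_unique (u : nat -> Z) (l l' : Z) : rlim u l -> rlim u l' -> l = l'.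
Proof.
move=> ul ul'; apply/eqP; rewrite -subr_eq0; apply/eqP/rnorm_eq0.
apply/eqP; rewrite eq_le rnorm_ge0 andbT; apply/ler_addgt0Pr => e e0.
rewrite add0r; have [n nP] := ul' _ e0.
exact: rlim_le ul nP.
Qed.

Lemma rlimD (u v : nat -> Z) (l l' : Z) : rlim u l -> rlim v l' ->
  rlim (fun n => u n + v n) (l + l').
Proof.
move=> ul vl e e0; have e20 : 0 < e / 2 by rewrite divr_gt0.
have [n nP] := ul _ e20; have [m mP] := vl _ e20.
exists (maxn n m) => k; rewrite geq_max => /andP[nk mk].
rewrite opprD addrACA (splitr e); apply: le_trans (rnormD _ _) _.
by apply: lerD; [exact: nP|exact: mP].
Qed.

Lemma rlim_lipschitz (A : Z -> Z) (C : R) (u : nat -> Z) (l : Z) :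
  (forall x y, `[A x - A y] <= C * `[x - y]) ->
  rlim u l -> rlim (A \o u) (A l).
Proof.
move=> AC ul e e0.
have C0 : 0 < `|C| + 1 by rewrite ltr_wpDl.
have [n nP] := ul (e / (`|C| + 1)) (divr_gt0 e0 C0).
exists n => m /nP; rewrite ler_pdivlMr// => h.
apply: le_trans (AC _ _) _; apply: le_trans h.
rewrite [leRHS]mulrC ler_wpM2r ?rnorm_ge0//.
by apply: le_trans (ler_norm _) _; rewrite lerDl.
Qed.

Lemma rlimZ (a : K) (u : nat -> Z) (l : Z) : rlim u l ->
  rlim (fun n => a *: u n) (a *: l).
Proof.
apply: (rlim_lipschitz (A := fun x => a *: x) (C := rnorm ofR a)) => x y.
by rewrite -scalerBr rnormZ.
Qed.

Lemma rlim_shift (u : nat -> Z) (l : Z) : rlim u l -> rlim (fun n => u n.+1) l.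
Proof.
by move=> ul e e0; have [n nP] := ul _ e0; exists n => m nm; apply: nP; exact: leqW.
Qed.

Lemma rlim_norm (u : nat -> Z) (l c : Z) : rlim u l ->
  (fun n => `[u n - c]) @ \oo --> `[l - c].
Proof.
move=> ul; apply/cvgrPdist_le => e e0; have [n nP] := ul _ e0.
exists n => // m /nP h; rewrite ler_distl; apply/andP; split.
  rewrite lerBlDr; apply: le_trans (rnorm_tri _ l _) _.
  by rewrite addrC lerD2l.
apply: le_trans (rnorm_tri _ (u m) _) _.
by rewrite addrC lerD2l rnormBC.
Qed.

End real_norm.

(** * Finitely valued functions *)

Section simple_functions.
Context d (X : measurableType d).

Definition simple_fun (S : Type) (f : X -> S) : Prop :=
  finite_set (range f) /\ forall v, measurable (f @^-1` [set v]).

Lemma simple_preimage (S : Type) (f : X -> S) (B : set S) :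
  simple_fun f -> measurable (f @^-1` B).
Proof.
move=> [ff mf].
have -> : f @^-1` B = \bigcup_(v in range f `&` B) f @^-1` [set v].
  apply/seteqP; split => [x Bx|x [v [_ Bv] /= fxv]]; last first.
    by rewrite /preimage/= fxv.
  by exists (f x) => //; split => //; exists x.
apply: fin_bigcup_measurable => [|v _]; last exact: mf.
by apply: sub_finite_set ff; exact: subIsetl.
Qed.

Lemma simple_comp (S S' : Type) (h : S -> S') (f : X -> S) :
  simple_fun f -> simple_fun (fun x => h (f x)).
Proof.
move=> sf; split.
  have -> : range (fun x => h (f x)) = h @` range f.
    by rewrite image_comp.
  exact/finite_image/sf.1.
by move=> v; exact: (simple_preimage (h @^-1` [set v])).
Qed.

Lemma simple_pair (S S' : Type) (f : X -> S) (g : X -> S') :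
  simple_fun f -> simple_fun g -> simple_fun (fun x => (f x, g x)).
Proof.
move=> [ff mf] [fg mg]; split.
  apply: sub_finite_set (finite_setX ff fg) => _ [x _ <-].
  by split; exists x.
move=> [a b].
have -> : (fun x => (f x, g x)) @^-1` [set (a, b)] =
    f @^-1` [set a] `&` g @^-1` [set b].
  by apply/seteqP; split => x; [case=> <- <-|case=> /= -> ->].
by apply: measurableI; [exact: mf|exact: mg].
Qed.

Lemma simple_comp2 (S1 S2 S3 : Type) (h : S1 -> S2 -> S3) (f : X -> S1)
    (g : X -> S2) :
  simple_fun f -> simple_fun g -> simple_fun (fun x => h (f x) (g x)).
Proof.
by move=> sf sg; exact: (simple_comp (fun p => h p.1 p.2) (simple_pair sf sg)).
Qed.

Lemma simple_cst (S : Type) (c : S) : simple_fun (fun _ : X => c).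
Proof.
split; first by apply: sub_finite_set (finite_set1 c) => _ [x _ <-].
move=> v; have [<-|cv] := pselect (c = v).
  by rewrite (_ : _ @^-1` _ = setT)//; apply/seteqP; split.
by rewrite (_ : _ @^-1` _ = set0)//; apply/seteqP; split.
Qed.

Lemma simple_indicator (B : set X) : measurable B ->
  simple_fun (fun x => `[< B x >]).
Proof.
move=> mB; split; first exact: finite_finset.
case.
  rewrite (_ : _ @^-1` _ = B)//.
  by apply/seteqP; split => x /=; [move/asboolP|move=> Bx; apply/asboolP].
rewrite (_ : _ @^-1` _ = ~` B); first exact: measurableC.
by apply/seteqP; split => x /=; [move/asboolPn|move=> Bx; apply/asboolPn].
Qed.

Lemma simple_precomp (S : Type) (f : X -> S) (g : X -> X) :
  simple_fun f -> (forall B, measurable B -> measurable (g @^-1` B)) ->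
  simple_fun (f \o g).
Proof.
move=> [ff mf] mg; split; last by move=> v; apply: mg (mf v).
by apply: sub_finite_set ff => _ [x _ <-]; exists (g x).
Qed.

Lemma simple_sum (V : zmodType) (F : nat -> X -> V) n m :
  (forall k, simple_fun (F k)) ->
  simple_fun (fun x => \sum_(n <= k < m) F k x).
Proof.
move=> sF; elim: m => [|m IHm].
  rewrite (_ : (fun x => _) = fun=> 0); first exact: simple_cst.
  by apply/funext => x; rewrite big_geq.
have [nm|mn] := leqP n m; last first.
  rewrite (_ : (fun x => _) = fun=> 0); first exact: simple_cst.
  by apply/funext => x; rewrite big_geq.
rewrite (_ : (fun x => _) = fun x => \sum_(n <= k < m) F k x + F m x).
  exact: simple_comp2.
by apply/funext => x; rewrite big_nat_recr.
Qed.

Lemma simple_range_seq (S : eqType) (f : X -> S) : simple_fun f ->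
  exists s : seq S, forall x, f x \in s.
Proof.
move=> [/finite_seqP[s fs] _]; exists s => x.
have : range f (f x) by exists x.
by rewrite fs.
Qed.

Lemma simple_measurable (R : realType) (f : X -> R) : simple_fun f ->
  measurable_fun setT f.
Proof. by move=> sf _ B mB; rewrite setTI; exact: simple_preimage. Qed.

(** [D] takes finitely many values on the range of [f], and [c] is a lower bound for the positive
    ones. All decoding rests on this passage from approximate to exact equality. *)
Lemma simple_gap (R : realFieldType) (S : Type) (f : X -> S) (D : S -> S -> R) :
  simple_fun f -> (forall a b, 0 <= D a b) ->
  exists2 c, 0 < c & forall x y, D (f x) (f y) < c -> D (f x) (f y) = 0.
Proof.
move=> [ff _] D0.
pose E := [set r | exists x y, D (f x) (f y) = r].
have : finite_set E.
  have := finite_image (fun p => D p.1 p.2) (finite_setX ff ff).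
  by apply: sub_finite_set => _ [x [y <-]]; exists (f x, f y).
move=> /finite_seqP[s sE].
suff [c c0 cP] : exists2 c, 0 < c & forall r, r \in s -> 0 < r -> c <= r.
  exists c => // x y xyc; apply/eqP; rewrite eq_le D0 andbT leNgt.
  apply/negP => xy0; have : E (D (f x) (f y)) by exists x, y.
  by rewrite sE => /cP -/(_ xy0); rewrite leNgt xyc.
elim: s {sE} => [|a s [c c0 cP]]; first by exists 1.
have [a0|a0] := ltP 0 a.
  exists (Num.min c a); first by rewrite lt_min c0.
  move=> r; rewrite inE => /predU1P[-> _|rs r0].
    by rewrite ge_min lexx orbT.
  by rewrite ge_min cP.
exists c => // r; rewrite inE => /predU1P[->|]; first by rewrite ltNge a0.
exact: cP.
Qed.

End simple_functions.

(** * Series with finitely valued multipliers *)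

Section multipliers.
Context (R : realType) (K : numFieldType) (ofR : {rmorphism R -> K}).
Hypothesis ofRP : real_embedding ofR.
Context (Z : completeNormedModType K) (w : nat -> Z).
Local Notation "`[ x ]" := (rnorm ofR x) (format "`[ x ]").

(** The Cauchy form of unconditional convergence, uniform over all finite sets of late indices. *)
Definition small_subsums : Prop := forall e : R, 0 < e -> exists n,
  forall (P : pred nat) n' m, (n <= n')%N -> `[\sum_(n' <= k < m | P k) w k] <= e.

Hypothesis w_sub : small_subsums.

(* Splitting a finitely valued multiplier along its values reduces it to
   subsums. *)
Lemma multiplier_tail (s : seq K) (e : R) : 0 < e -> exists n,
  forall (b : nat -> K) n' m, (forall k, b k \in s) -> (n <= n')%N ->
    `[\sum_(n' <= k < m) b k *: w k] <= e.
Proof.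
move=> e0; pose C : R := \sum_(v <- undup s) `[v] + 1.
have C0 : 0 < C by rewrite ltr_wpDl// sumr_ge0// => v _; exact: rnorm_ge0.
have [n nP] := w_sub (divr_gt0 e0 C0).
exists n => b n' m bs nn'.
have -> : \sum_(n' <= k < m) b k *: w k =
    \sum_(v <- undup s) v *: \sum_(n' <= k < m | b k == v) w k.
  transitivity (\sum_(n' <= k < m) \sum_(v <- undup s | v == b k) v *: w k).
    apply: eq_bigr => k _; rewrite -big_filter filter_pred1_uniq ?undup_uniq//.
      by rewrite big_seq1.
    by rewrite mem_undup.
  rewrite (exchange_big_dep predT)//=; apply: eq_bigr => v _.
  by rewrite scaler_sumr; apply: eq_bigl => k; rewrite eq_sym.
apply: le_trans (rnorm_sum ofRP _ _ _) _.
apply: (@le_trans _ _ (\sum_(v <- undup s) `[v] * (e / C))).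
  apply: ler_sum => v _; rewrite rnormZ// ler_wpM2l ?rnorm_ge0//.
  exact: (nP (fun k => b k == v)).
rewrite -mulr_suml mulrCA ler_piMr ?(ltW e0)// ler_pdivrMr// mul1r.
by rewrite lerDl.
Qed.

Definition finitely_valued (b : nat -> K) := exists s : seq K, forall k, b k \in s.

Definition partial (b : nat -> K) (m : nat) : Z := \sum_(0 <= k < m) b k *: w k.

Definition wsum (b : nat -> K) : Z := xget 0 [set l | rlim ofR (partial b) l].

Lemma partial_split (b : nat -> K) n m : (n <= m)%N ->
  partial b m - partial b n = \sum_(n <= k < m) b k *: w k.
Proof.
by move=> nm; rewrite /partial (big_cat_nat (n := n))//= addrAC subrr add0r.
Qed.

Lemma wsum_lim (b : nat -> K) : finitely_valued b ->
  rlim ofR (partial b) (wsum b).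
Proof.
move=> [s bs]; rewrite /wsum; case: xgetP => // nl.
have [|l lP] := @rlim_complete _ _ _ ofRP Z (partial b); last by have := nl l.
move=> e e0; have [n nP] := multiplier_tail s e0; exists n => m nm.
by rewrite partial_split//; exact: nP.
Qed.

Lemma wsum_eq (b : nat -> K) l : finitely_valued b ->
  rlim ofR (partial b) l -> wsum b = l.
Proof. by move=> /wsum_lim bl bl'; exact: (rlim_unique ofRP bl bl'). Qed.

(** The cut-off depends on the set of values alone, so it can be fixed before the coefficients are
    known. *)
Lemma wsum_tail (s : seq K) (e : R) : 0 < e -> exists n,
  forall (b : nat -> K) n', (forall k, b k \in s) -> (n <= n')%N ->
    `[wsum b - partial b n'] <= e.
Proof.
move=> e0; have [n nP] := multiplier_tail s e0; exists n => b n' bs nn'.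
have bl : rlim ofR (partial b) (wsum b) by apply: wsum_lim; exists s.
apply: (rlim_le ofRP (n := n') bl) => m n'm.
by rewrite partial_split//; exact: nP.
Qed.

Lemma partialD b c m : partial (fun k => b k + c k) m = partial b m + partial c m.
Proof. by rewrite -big_split; apply: eq_bigr => k _; rewrite scalerDl. Qed.

Lemma partialZ a b m : partial (fun k => a * b k) m = a *: partial b m.
Proof. by rewrite scaler_sumr; apply: eq_bigr => k _; rewrite scalerA. Qed.

Lemma finitely_valuedD b c : finitely_valued b -> finitely_valued c ->
  finitely_valued (fun k => b k + c k).
Proof.
move=> [s bs] [t ct]; exists [seq x + y | x <- s, y <- t] => k.
exact: allpairs_f.
Qed.

Lemma finitely_valuedZ a b : finitely_valued b ->
  finitely_valued (fun k => a * b k).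
Proof. by move=> [s bs]; exists [seq a * x | x <- s] => k; exact: map_f. Qed.

Lemma wsumD b c : finitely_valued b -> finitely_valued c ->
  wsum (fun k => b k + c k) = wsum b + wsum c.
Proof.
move=> fb fc; apply: wsum_eq; first exact: finitely_valuedD.
have := rlimD ofRP (wsum_lim fb) (wsum_lim fc).
by congr (rlim _ _ _); apply/funext => m; rewrite partialD.
Qed.

Lemma wsumZ a b : finitely_valued b -> wsum (fun k => a * b k) = a *: wsum b.
Proof.
move=> fb; apply: wsum_eq; first exact: finitely_valuedZ.
have := rlimZ ofRP a (wsum_lim fb).
by congr (rlim _ _ _); apply/funext => m; rewrite partialZ.
Qed.

Lemma wsumB b c : finitely_valued b -> finitely_valued c ->
  wsum (fun k => b k - c k) = wsum b - wsum c.
Proof.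
move=> fb fc; rewrite -scaleN1r -wsumZ// -wsumD//; last exact: finitely_valuedZ.
by congr wsum; apply/funext => k; rewrite mulN1r.
Qed.

(** Finitely many terms are bounded by the triangle inequality, the rest by 1 uniformly in [Q]. This
    controls the effect of adding a multiple of [visit B]. *)
Lemma wsum_indicator_bound : exists2 C : R, 0 <= C &
  forall Q : nat -> bool, `[wsum (fun k => (Q k)%:R)] <= C.
Proof.
have [n nP] := wsum_tail [:: 0; 1] ltr01.
exists (\sum_(0 <= k < n) `[w k] + 1).
  by rewrite addr_ge0// sumr_ge0// => k _; exact: rnorm_ge0.
move=> Q; set b := fun k => _.
have bs k : b k \in [:: 0; 1] by rewrite /b; case: (Q k); rewrite !inE eqxx ?orbT.
rewrite -(subrK (partial b n) (wsum b)) addrC.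
apply: le_trans (rnormD ofRP _ _) _; apply: lerD; last exact: nP.
apply: le_trans (rnorm_sum ofRP _ _ _) _; apply: ler_sum => k _.
rewrite /b; case: (Q k); rewrite ?scale1r// scale0r rnorm0//.
exact: rnorm_ge0.
Qed.

Lemma wsum_head b c : finitely_valued b -> finitely_valued c ->
  (forall k, b k.+1 = c k.+1) -> wsum b - wsum c = (b 0%N - c 0%N) *: w 0%N.
Proof.
move=> fb fc bc; rewrite -wsumB//; apply: wsum_eq.
  apply: finitely_valuedD => //.
  have [s cs] := fc; exists [seq - x | x <- s] => k; exact: map_f.
move=> e e0; exists 1%N => -[//|m] _.
rewrite /partial big_nat_recl// big1 ?addr0 ?subrr ?rnorm0 ?ltW// => k _.
by rewrite bc subrr scale0r.
Qed.

Lemma wsum_shift (A : {linear Z -> Z}) (C : R) (b : nat -> K) :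
  (forall x y, `[A x - A y] <= C * `[x - y]) ->
  A (w 0%N) = 0 -> (forall k, A (w k.+1) = w k) -> finitely_valued b ->
  A (wsum b) = wsum (b \o S).
Proof.
move=> AC A0 AS fb; apply/esym/wsum_eq.
  by have [s bs] := fb; exists s => k; exact: bs.
have := rlim_shift (rlim_lipschitz ofRP AC (wsum_lim fb)).
congr (rlim _ _ _); apply/funext => m /=.
rewrite /partial big_nat_recl// linearD linearZ_LR A0 scaler0 add0r linear_sum.
by apply: eq_bigr => k _; rewrite linearZ_LR AS.
Qed.

End multipliers.

(* Being a distance to the span of [w L, w L.+1, ...], [head_norm] only sees the
   first [L] coefficients of a series in the [w k]. *)
Section head_seminorm.
Context (R : realType) (K : numFieldType) (ofR : {rmorphism R -> K}).
Hypothesis ofRP : real_embedding ofR.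
Context (Z : completeNormedModType K) (w : nat -> Z) (L : nat).
Local Notation "`[ x ]" := (rnorm ofR x) (format "`[ x ]").

Definition tail_span : set Z :=
  [set v | exists N (a : nat -> K), v = \sum_(L <= k < N) a k *: w k].

Definition head_norm (y : Z) : R := inf [set `[y - m] | m in tail_span].

Lemma tail_span0 : tail_span 0.
Proof. by exists 0%N, (fun=> 0); rewrite big_geq. Qed.

Lemma tail_span_w k : (L <= k)%N -> tail_span (w k).
Proof.
move=> Lk; exists k.+1, (fun i => (i == k)%:R).
rewrite big_nat_recr//= eqxx scale1r big1_seq ?add0r// => i.
by rewrite mem_index_iota => /andP[_ /andP[_ ik]]; rewrite ltn_eqF// scale0r.
Qed.

Lemma tail_span_widen N N' (a : nat -> K) : (N <= N')%N ->
  \sum_(L <= k < N) a k *: w k =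
  \sum_(L <= k < N') (if (k < N)%N then a k else 0) *: w k.
Proof.
move=> NN'; have [LN|NL] := leqP L N.
  rewrite [RHS](big_cat_nat (n := N))//= [X in _ + X]big1_seq ?addr0.
    by apply: eq_big_nat => k /andP[_ ->].
  by move=> k; rewrite mem_index_iota => /andP[_ /andP[Nk _]];
    rewrite ltnNge Nk scale0r.
rewrite big_geq ?(ltnW NL)// big1_seq// => k.
rewrite mem_index_iota => /andP[_ /andP[Lk _]].
by rewrite ltnNge (leq_trans (ltnW NL) Lk) scale0r.
Qed.

Lemma tail_spanD u v : tail_span u -> tail_span v -> tail_span (u + v).
Proof.
move=> [N [a ->]] [N' [a' ->]].
rewrite (tail_span_widen a (leq_maxl N N')) (tail_span_widen a' (leq_maxr N N')).
exists (maxn N N'), (fun k => (if (k < N)%N then a k else 0) +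
  (if (k < N')%N then a' k else 0)).
by rewrite -big_split; apply: eq_bigr => k _; rewrite scalerDl.
Qed.

Lemma tail_spanZ c u : tail_span u -> tail_span (c *: u).
Proof.
move=> [N [a ->]]; exists N, (fun k => c * a k).
by rewrite scaler_sumr; apply: eq_bigr => k _; rewrite scalerA.
Qed.

Let has_inf_head y : has_inf [set `[y - m] | m in tail_span].
Proof.
split; first by exists (`[y - 0]), 0 => //; exact: tail_span0.
by exists 0 => _ [m _ <-]; exact: rnorm_ge0.
Qed.

Lemma head_norm_le y m : tail_span m -> head_norm y <= `[y - m].
Proof. by move=> Mm; apply: (ge_inf (has_inf_head y).2); exists m. Qed.

Lemma head_norm_near y (e : R) : 0 < e ->
  exists2 m, tail_span m & `[y - m] < head_norm y + e.
Proof.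
move=> e0; have [_ [m Mm <-] h] := inf_adherent e0 (has_inf_head y).
by exists m.
Qed.

Lemma head_norm_ge0 y : 0 <= head_norm y.
Proof.
by apply: lb_le_inf (has_inf_head y).1 _ => _ [m _ <-]; exact: rnorm_ge0.
Qed.

Lemma head_norm_ler y : head_norm y <= `[y].
Proof. by rewrite -[in leRHS](subr0 y) head_norm_le//; exact: tail_span0. Qed.

Lemma head_normD x y : head_norm (x + y) <= head_norm x + head_norm y.
Proof.
apply/ler_addgt0Pr => e e0; have e20 : 0 < e / 2 by rewrite divr_gt0.
have [m Mm xm] := head_norm_near x e20.
have [n Mn yn] := head_norm_near y e20.
apply: le_trans (head_norm_le _ (tail_spanD Mm Mn)) _.
rewrite opprD addrACA (splitr e) [leRHS]addrACA.
apply: le_trans (rnormD ofRP _ _) _.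
by apply: ltW; apply: ltrD.
Qed.

Lemma head_norm_eq0 m : (forall e : R, 0 < e ->
  exists2 n, tail_span n & `[m - n] <= e) -> head_norm m = 0.
Proof.
move=> h; apply/eqP; rewrite eq_le head_norm_ge0 andbT.
apply/ler_addgt0Pr => e e0; rewrite add0r; have [n Mn mn] := h _ e0.
exact: le_trans (head_norm_le _ Mn) mn.
Qed.

Lemma head_norm_span m : tail_span m -> head_norm m = 0.
Proof.
move=> Mm; apply: head_norm_eq0 => e e0; exists m => //.
by rewrite subrr rnorm0// ltW.
Qed.

Lemma head_normZ a x : head_norm (a *: x) <= `[a] * head_norm x.
Proof.
apply/ler_addgt0Pr => e e0.
have a1 : 0 < `[a] + 1 by rewrite ltr_wpDl// rnorm_ge0.
have [m Mm xm] := head_norm_near x (divr_gt0 e0 a1).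
apply: le_trans (head_norm_le _ (tail_spanZ a Mm)) _.
rewrite -scalerBr rnormZ//.
apply: (@le_trans _ _ (`[a] * (head_norm x + e / (`[a] + 1)))).
  by rewrite ler_wpM2l ?rnorm_ge0// ltW.
rewrite mulrDr lerD2l mulrCA ler_piMr ?(ltW e0)// ler_pdivrMr// mul1r.
by rewrite lerDl.
Qed.

Lemma head_normN x : head_norm (- x) = head_norm x.
Proof.
have h y : head_norm (- y) <= head_norm y.
  rewrite -scaleN1r; apply: le_trans (head_normZ _ _) _.
  by rewrite rnormN// -(rmorph1 ofR) rnorm_ofR// mul1r.
by apply/eqP; rewrite eq_le h -[X in head_norm X <= _]opprK h.
Qed.

Lemma head_normB x y : head_norm (x - y) <= head_norm x + head_norm y.
Proof. by rewrite -(head_normN y) head_normD. Qed.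

Lemma head_norm_congr x y : head_norm (x - y) = 0 -> head_norm x = head_norm y.
Proof.
move=> xy0; apply/eqP; rewrite eq_le; apply/andP; split.
  by rewrite -[x](subrK y); apply: le_trans (head_normD _ _) _; rewrite xy0 add0r.
have -> : y = x - (x - y) by rewrite opprB addrC subrK.
by apply: le_trans (head_normB _ _) _; rewrite xy0 addr0.
Qed.

Hypothesis w_sub : small_subsums ofR w.

Lemma head_norm_wsum b : finitely_valued b ->
  head_norm (wsum ofR w b - partial w b L) = 0.
Proof.
move=> fb; apply: head_norm_eq0 => e e0.
have [n nP] := wsum_lim ofRP w_sub fb e0.
exists (\sum_(L <= k < maxn n L) b k *: w k); first by exists (maxn n L), b.
rewrite -partial_split ?leq_maxr// opprB addrA subrK rnormBC//.
by apply: nP; rewrite leq_maxl.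
Qed.

(** Leaves only [L] coefficients; for a finitely valued function these give finitely many values, to
    which [simple_gap] applies. *)
Lemma head_norm_wsumB b c : finitely_valued b -> finitely_valued c ->
  head_norm (wsum ofR w b - wsum ofR w c) =
  head_norm (partial w b L - partial w c L).
Proof.
move=> fb fc; apply: head_norm_congr.
apply/eqP; rewrite eq_le head_norm_ge0 andbT.
rewrite (_ : _ - _ = (wsum ofR w b - partial w b L) -
    (wsum ofR w c - partial w c L)); last first.
  by rewrite !opprB addrACA [RHS]addrACA; congr (_ + _); rewrite addrC.
apply: le_trans (head_normB _ _) _.
by rewrite !head_norm_wsum// addr0.
Qed.

End head_seminorm.

(** * The coding map and one step of the construction *)

Section coding.
Context (R : realType) (K : numFieldType) (ofR : {rmorphism R -> K}).
Hypothesis ofRP : real_embedding ofR.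
Context (Z : completeNormedModType K) (w : nat -> Z).
Local Notation "`[ x ]" := (rnorm ofR x) (format "`[ x ]").
Hypothesis w_sub : small_subsums ofR w.
Context d (X : measurableType d) (mu : probability X R) (T : X -> X).
Hypothesis ergT : ergodic mu T.
Let mpT : measure_preserving mu T := ergT.1.

Definition coding (f : X -> K) (x : X) : Z :=
  wsum ofR w (fun k => f (iter k T x)).

Lemma simple_iter (S : Type) (f : X -> S) k : simple_fun f ->
  simple_fun (fun x => f (iter k T x)).
Proof.
move=> sf; apply: (simple_precomp (g := iter k T)) => // B mB.
exact: (measurable_preimage_iter mpT).
Qed.

Lemma simple_orbit (f : X -> K) x : simple_fun f ->
  finitely_valued (fun k => f (iter k T x)).
Proof. by move=> /simple_range_seq[s fs]; exists s. Qed.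

Lemma simple_partial (f : X -> K) m : simple_fun f ->
  simple_fun (fun x => partial w (fun k => f (iter k T x)) m).
Proof.
move=> sf; apply: simple_sum => k.
exact: (simple_comp (fun v : K => v *: w k)) (simple_iter k sf).
Qed.

Lemma codingB (f g : X -> K) x : simple_fun f -> simple_fun g ->
  coding f x - coding g x = coding (fun y => f y - g y) x.
Proof. by move=> sf sg; rewrite -wsumB//; exact: simple_orbit. Qed.

(** The distance to a fixed vector is a pointwise limit of finitely valued functions, and it stands
    in for measurability into [Z]. *)
Lemma measurable_coding_dist (f : X -> K) (c : Z) : simple_fun f ->
  measurable_fun setT (fun x => `[coding f x - c]).
Proof.
move=> sf.
apply: (@measurable_fun_cvg _ _ _ _
  (fun m x => `[partial w (fun k => f (iter k T x)) m - c])).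
  move=> m; apply: simple_measurable.
  exact: (simple_comp (fun v => `[v - c])) (simple_partial m sf).
move=> x _; apply: rlim_norm => //.
by apply: (wsum_lim ofRP w_sub); exact: simple_orbit.
Qed.

Lemma measurable_coding_le (f : X -> K) (c : Z) (r : R) : simple_fun f ->
  measurable [set x | `[coding f x - c] <= r].
Proof.
move=> sf; have := measurable_coding_dist c sf measurableT.
move=> /(_ `]-oo, r]%classic (measurable_itv _)); rewrite setTI.
by congr (measurable _); apply/seteqP; split => x /=; rewrite in_itv.
Qed.

Lemma measurable_coding_gt (f g : X -> K) (r : R) :
  simple_fun f -> simple_fun g ->
  measurable [set x | r < `[coding f x - coding g x]].
Proof.
move=> sf sg.
have sfg : simple_fun (fun y => f y - g y) by exact: (simple_comp2 (fun u v => u - v)) sf sg.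
have := measurableC (measurable_coding_le 0 r sfg).
congr (measurable _); apply/seteqP; split => x /=.
  by rewrite codingB// subr0 ltNge => /negP.
by rewrite codingB// subr0 ltNge => /negP.
Qed.

Hypothesis stdX : standard_lebesgue mu.

(** The members of the sparse family of measure at most [eps] cover almost every point, so one of
    them is not null. *)
Lemma sparse_set (N : nat) (eps : R) : 0 < eps -> exists B : set X,
  [/\ measurable B, (0 < mu B)%E, (mu B <= eps%:E)%E &
    forall x i, (i < N)%N -> B x -> ~ B (iter i.+1 T x)].
Proof.
move=> e0.
have [B [Y [mB Bsp nY BP]]] := sparse_family mpT ergT stdX N.
pose B' k := if (mu (B k) <= eps%:E)%E then B k else set0.
have mB' k : measurable (B' k).
  by rewrite /B'; case: ifP => _; [exact: mB|exact: measurable0].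
have [k Bk] : exists k, (0 < mu (B' k))%E.
  apply: contrapT => /forallNP nk.
  have : mu.-negligible (\bigcup_k B' k).
    apply: negligible_bigcup => k; apply/negligibleP => //.
    apply/eqP; rewrite eq_le measure_ge0 andbT.
    by have /negP := nk k; rewrite -leNgt.
  move=> nB'; have [||x [_ [nx Yx]]] :=
      @negligible_meet _ _ _ mu setT (~` (\bigcup_k B' k) `&` Y) measurableT.
  - by rewrite probability_setT.
  - by rewrite setCI setCK; exact: negligibleU.
  have [k [Bk _ muk]] := BP x x eps e0 Yx Yx.
  by apply: nx; exists k => //; rewrite /B' muk.
exists (B' k); split => //.
  by rewrite /B'; case: ifP => //; rewrite measure0 lee_fin (ltW e0).
by move=> x i iN; rewrite /B'; case: ifP => // _; exact: Bsp.
Qed.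

Lemma find_nth (s : seq bool) (j : nat) : nth false s j ->
  (forall i, (i < j)%N -> ~~ nth false s i) -> find id s = j.
Proof.
move=> sj si; case: (ltngtP (find id s) j) => // [fj|jf].
  have := si _ fj; rewrite (@nth_find _ false id)//.
  apply/(has_nthP false); exists j => //.
  by rewrite ltnNge; apply: contraTN sj => /(nth_default false) ->.
by have := before_find false jf; rewrite /= sj.
Qed.

Section tower.
Variables (B : set X) (N : nat) (f : X -> K) (a : nat -> K).

(* Overrides [f] on the tower [B, T^-1 B, ..., T^-N B] so that the orbit of a
   point of [T^-N B] reads [a 0, ..., a N]. *)
Definition tower_override (y : X) : K :=
  let i := find id [seq `[< B (iter i T y) >] | i <- iota 0 N.+1] in
  if (i <= N)%N then a (N - i) else f y.

Lemma tower_overrideE x k :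
  (forall x i, (i < N)%N -> B x -> ~ B (iter i.+1 T x)) ->
  B (iter N T x) -> (k <= N)%N -> tower_override (iter k T x) = a k.
Proof.
(* Sparseness makes [N - k] the first time at which [T^k x] meets [B]: an earlier visit would be
   followed too soon by the one at time [N] of the orbit of [x]. *)
move=> sp Bx kN; rewrite /tower_override (@find_nth _ (N - k)).
- by rewrite leq_subr subKn.
- rewrite (nth_map 0%N) ?size_iota ?ltnS ?leq_subr//.
  rewrite nth_iota ?ltnS ?leq_subr// add0n -iterD subnK//.
  by apply/asboolP.
- move=> i ik; rewrite (nth_map 0%N) ?size_iota; last by lia.
  rewrite nth_iota ?add0n; last by lia.
  apply/asboolPn => Bi.
  have := sp _ (N - k - i).-1 _ Bi; apply; first by lia.
  have -> : iter (N - k - i).-1.+1 T (iter i T (iter k T x)) = iter N T x.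
    by rewrite -!iterD; apply: (congr1 (fun m => iter m T x)); lia.
  exact: Bx.
Qed.

Lemma tower_override_out y : (forall i, (i <= N)%N -> ~ B (iter i T y)) ->
  tower_override y = f y.
Proof.
move=> nB; rewrite /tower_override hasNfind; first by rewrite size_map size_iota ltnn.
apply/hasPn => _ /mapP[i + ->]; rewrite mem_iota ltnS => /nB.
by move=> nBi; apply/asboolPn.
Qed.

Lemma tower_override_range y :
  tower_override y = f y \/ exists i, tower_override y = a i.
Proof. by rewrite /tower_override; case: ifP => _; [right; eexists|left]. Qed.

Lemma simple_tower_override : measurable B -> simple_fun f ->
  simple_fun tower_override.
Proof.
move=> mB sf.
apply: (simple_comp2 (fun (s : seq bool) (u : K) =>
  if (find id s <= N)%N then a (N - find id s) else u)) => //.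
elim: (iota 0 N.+1) => [|i l IHl] /=; first exact: simple_cst.
apply: (simple_comp2 cons) => //.
exact: (@simple_iter _ (fun x => `[< B x >])) (simple_indicator mB).
Qed.

End tower.

Hypothesis w_dense : forall (z : Z) (e : R), 0 < e ->
  exists N (a : nat -> K), `[\sum_(0 <= k < N) a k *: w k - z] <= e.

(** The tower is thin enough to be negligible in measure and tall enough to cover the head of the
    series. Points of [T^-N B] read the coefficients of a combination close to [z]; off a tower
    about twice as tall, the first [N.+1] coefficients are unchanged and the sum moves by a tail
    only. *)
Lemma steer (f : X -> K) (delta : R) (z : Z) : simple_fun f -> 0 < delta ->
  exists g, [/\ simple_fun g,
    (mu [set x | (delta < `[coding g x - coding f x])%R] <= delta%:E)%E &
    (0 < mu [set x | (`[coding g x - z] <= delta)%R])%E].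
Proof.
move=> sf d0; have d20 : 0 < delta / 2 by rewrite divr_gt0.
have [N0 [a aP]] := w_dense z d20.
pose a' k := if (k < N0)%N then a k else 0.
have [sq fsq] := simple_range_seq sf.
(* [s1] and [s2] contain all values of [g] and of [g - f] whatever the tower is, so both tail
   estimates can precede the choice of its height. *)
pose s1 := 0 :: [seq a k | k <- iota 0 N0] ++ sq.
have a's1 k : a' k \in s1.
  rewrite /a' /s1 inE mem_cat; case: ifP => kN0; last by rewrite eqxx.
  by rewrite map_f ?orbT// mem_iota.
pose s2 := [seq u - v | u <- s1, v <- sq].
have [n1 n1P] := wsum_tail ofRP w_sub s1 d20.
have [n2 n2P] := wsum_tail ofRP w_sub s2 d0.
pose N := maxn N0 (maxn n1 n2).
(* A change among the first [N.+1] coefficients forces a visit to [B] at a time at most [2 * N]; the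
   preimages of [B] up to that time must have total measure at most [delta]. *)
have e0 : 0 < delta / (N.+1 + N.+1)%:R by rewrite divr_gt0// ltr0n.
have [B [mB B0 Be Bsp]] := sparse_set N e0.
pose g := tower_override B N f a'.
have sg : simple_fun g by exact: simple_tower_override.
have gs1 y : g y \in s1.
  rewrite /g; case: (tower_override_range B N f a' y) => [->|[i ->]]; last exact: a's1.
  by rewrite inE mem_cat fsq !orbT.
exists g; split => //.
- pose H : set X := \bigcup_(j in `I_(N.+1 + N.+1)) iter j T @^-1` B.
  have mI j : measurable (iter j T @^-1` B).
    exact: (measurable_preimage_iter mpT).
  apply: (@le_trans _ _ (mu H)).
    apply: le_measure; rewrite ?inE.
    + exact: measurable_coding_gt.
    + by apply: bigcup_measurable => j _.
    + move=> x /= gf; apply: contrapT => nH; move: gf; apply/negP.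
      rewrite -leNgt codingB//.
      have n2N : (n2 <= N.+1)%N by rewrite leqW// !leq_max leqnn !orbT.
      have := n2P (fun k => g (iter k T x) - f (iter k T x)) N.+1 _ n2N.
      have -> : partial w (fun k => g (iter k T x) - f (iter k T x)) N.+1 = 0.
        rewrite /partial big1_seq// => k; rewrite mem_index_iota => /andP[_ kN].
        rewrite /g tower_override_out ?subrr ?scale0r// => i iN.
        rewrite -iterD => Bi; apply: nH; exists (i + k)%N => //=.
        by move: kN iN; lia.
      rewrite subr0; apply => k; apply: allpairs_f => //; exact: fsq.
  rewrite /H bigcup_mkord.
  have mI' j : (j < N.+1 + N.+1)%N -> measurable (iter j T @^-1` B) by [].
  apply: (le_trans (Boole_inequality mu mI')).
  apply: (@le_trans _ _ (\sum_(j < N.+1 + N.+1)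
      (delta / (N.+1 + N.+1)%:R)%:E)%E).
    have muj j : (mu (iter j T @^-1` B) <= (delta / (N.+1 + N.+1)%:R)%:E)%E.
      by rewrite (measure_preimage_iter mpT).
    by apply: lee_sum => j _; exact: muj.
  by rewrite sumEFin lee_fin sumr_const card_ord -[leLHS]mulr_natr divfK// pnatr_eq0.
- apply: (@lt_le_trans _ _ (mu (iter N T @^-1` B))).
    by rewrite (measure_preimage_iter mpT).
  apply: le_measure; rewrite ?inE.
  + exact: (measurable_preimage_iter mpT).
  + exact: measurable_coding_le.
  + move=> x /= Bx.
    have n1N : (n1 <= N.+1)%N by rewrite leqW// !leq_max leqnn !orbT.
    have := n1P (fun k => g (iter k T x)) N.+1 (fun k => gs1 _) n1N.
    have -> : partial w (fun k => g (iter k T x)) N.+1 =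
        \sum_(0 <= k < N0) a k *: w k.
      rewrite /partial (big_cat_nat (n := N0))//=; last by rewrite leqW// leq_maxl.
      rewrite [X in _ + X]big1_seq ?addr0.
        apply: eq_big_nat => k /andP[_ kN0].
        rewrite /g tower_overrideE//; first by rewrite /a' kN0.
        by rewrite ltnW// (leq_trans kN0)// leq_maxl.
      move=> k; rewrite mem_index_iota => /andP[_ /andP[N0k kN]].
      by rewrite /g tower_overrideE// /a' ltnNge N0k scale0r.
    move=> h; rewrite (splitr delta).
    apply: le_trans (rnorm_tri ofRP _ _ _) _; exact: lerD h aP.
Qed.

Definition visit (B : set X) (x : X) : K := (`[< B x >])%:R.

Lemma simple_visit B : measurable B -> simple_fun (visit B).
Proof.
by move=> mB; exact: (simple_comp (fun b : bool => b%:R)) (simple_indicator mB).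
Qed.

Hypothesis w0_neq0 : w 0%N != 0.
Variable L : nat.
Local Notation p := (head_norm ofR w L).

(* [rho] is below the gaps of the finitely many values taken by [f], so those
   values can still be told apart after adding [rho * visit B]. *)
Lemma mark (f : X -> K) (delta : R) (B : set X) : simple_fun f -> 0 < delta ->
  measurable B ->
  exists g (c : R), [/\ simple_fun g, 0 < c,
    forall x, `[coding g x - coding f x] <= delta,
    forall x y, p (coding g x - coding g y) <= c ->
      p (coding (visit B) x - coding (visit B) y) = 0 &
    forall x y, T x = T y -> `[coding g x - coding g y] <= c -> B x -> B y].
Proof.
move=> sf d0 mB; have sB := simple_visit mB.
pose G (f : X -> K) x := partial w (fun k => f (iter k T x)) L.
have sG h : simple_fun h -> simple_fun (G h) by exact: simple_partial.
have pG h x y : simple_fun h ->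
    p (coding h x - coding h y) = p (G h x - G h y).
  by move=> sh; rewrite head_norm_wsumB//; exact: simple_orbit.
have [S S0 SP] := wsum_indicator_bound ofRP w_sub.
have [c1 c10 c1P] := simple_gap (D := fun a b => p (a - b)) (sG _ sf)
  (fun a b => head_norm_ge0 ofRP _ _ _).
have [c2 c20 c2P] := simple_gap (D := fun a b : K => `[a - b]) sf
  (fun a b => rnorm_ge0 ofRP _).
pose m := Num.min delta (Num.min c1 c2).
have m0 : 0 < m by rewrite !lt_min d0 c10.
have S1 : 0 < S + S + 2 by rewrite ltr_wpDl// addr_ge0.
(* Two codings of [visit B] differ by at most [S + S], so this denominator keeps both their
   contribution and [rho] itself strictly below the gaps. *)
pose rho := m / (S + S + 2).
have rho0 : 0 < rho by rewrite divr_gt0.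
have rhoE : `[ofR rho] = rho by rewrite rnorm_ofR// ltW.
have rhoSS : rho * (S + S) < m.
  by rewrite /rho mulrAC ltr_pdivrMr// ltr_pM2l// ltrDl.
have rhoS : rho * S <= m.
  apply: le_trans (ltW rhoSS); rewrite ler_wpM2l ?(ltW rho0)//.
  by rewrite lerDl.
have rhom : rho < m.
  rewrite /rho ltr_pdivrMr// ltr_pMr//.
  by apply: (@lt_le_trans _ _ 2); rewrite ?ltr1n// lerDr addr_ge0.
have md : m <= delta by rewrite ge_min lexx.
have mc1 : m <= c1 by rewrite !ge_min lexx orbT.
have mc2 : m <= c2 by rewrite !ge_min lexx !orbT.
pose g x := f x + ofR rho * visit B x.
have sg : simple_fun g.
  exact: (simple_comp2 (fun u v => u + ofR rho * v)).
have gE x : coding g x = coding f x + ofR rho *: coding (visit B) x.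
  have ofx := simple_orbit x sf; have oB := simple_orbit x sB.
  rewrite /coding -(wsumZ ofRP w_sub _ oB).
  by rewrite -(wsumD ofRP w_sub ofx (finitely_valuedZ _ oB)).
have SB x : `[coding (visit B) x] <= S.
  exact: (SP (fun k => `[< B (iter k T x) >])).
have [c3 c30 c3P] := simple_gap (D := fun a b => p (a - b)) (sG _ sg)
  (fun a b => head_norm_ge0 ofRP _ _ _).
have [c4 c40 c4P] := simple_gap (D := fun a b : K => `[a - b]) sg
  (fun a b => rnorm_ge0 ofRP _).
have w00 : 0 < `[w 0%N] by exact: rnorm_gt0.
(* [c3] and [c4] are gaps of [g] itself, available once [rho] is fixed. Halving allows a non-strict
   bound in the conclusion, and the norm of [w 0] converts a distance of sums into one of values. *)
pose c := Num.min (c3 / 2) (c4 * `[w 0%N] / 2).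
have c0 : 0 < c by rewrite lt_min !divr_gt0 ?mulr_gt0.
have cc3 : c < c3.
  apply: (@le_lt_trans _ _ (c3 / 2)); first by rewrite ge_min lexx.
  by rewrite ltr_pdivrMr// ltr_pMr// ltr1n.
have cc4 : c < c4 * `[w 0%N].
  apply: (@le_lt_trans _ _ (c4 * `[w 0%N] / 2)); first by rewrite ge_min lexx orbT.
  by rewrite ltr_pdivrMr// ltr_pMr ?mulr_gt0// ltr1n.
exists g, c; split => //.
- move=> x; rewrite gE addrC addKr rnormZ// rhoE.
  by apply: le_trans md; apply: le_trans rhoS; rewrite ler_wpM2l// ltW.
- move=> x y; rewrite pG// => gxy.
  (* The gap of [g] makes [p] vanish exactly. Then [f] contributes less than [c1], hence nothing,
     and so the part coming from [B] vanishes as well. *)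
  have {gxy} := c3P x y (le_lt_trans gxy cc3); rewrite -pG// => gxy.
  pose D := coding (visit B) x - coding (visit B) y.
  have gD : coding g x - coding g y = (coding f x - coding f y) + ofR rho *: D.
    by rewrite !gE opprD addrACA scalerBr.
  have fxy : p (coding f x - coding f y) = 0.
    rewrite pG//; apply: c1P; rewrite -pG//; apply: lt_le_trans mc1.
    rewrite -[X in p X](addrK (ofR rho *: D)) -gD.
    apply: le_lt_trans (head_normB ofRP _ _ _ _) _; rewrite gxy add0r.
    apply: le_lt_trans (head_norm_ler ofRP _ _ _) _.
    rewrite rnormZ// rhoE; apply: le_lt_trans rhoSS.
    rewrite ler_wpM2l ?(ltW rho0)//.
    by apply: le_trans (rnormB ofRP _ _) _; apply: lerD.
  have rD : p (ofR rho *: D) = 0.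
    have -> : ofR rho *: D = (coding g x - coding g y) - (coding f x - coding f y).
      by rewrite gD addrC addKr.
    apply/eqP; rewrite eq_le head_norm_ge0// andbT.
    by apply: le_trans (head_normB ofRP _ _ _ _) _; rewrite gxy fxy addr0.
  apply/eqP; rewrite eq_le head_norm_ge0// andbT.
  have -> : coding (visit B) x - coding (visit B) y = (ofR rho)^-1 *: (ofR rho *: D).
    by rewrite scalerA mulVf ?scale1r// fmorph_eq0 gt_eqF.
  by apply: le_trans (head_normZ ofRP _ _ _ _) _; rewrite rD mulr0.
- move=> x y Txy; rewrite wsum_head//; try exact: simple_orbit; last first.
    by move=> k; rewrite !iterSr Txy.
  rewrite /= rnormZ// => gxy Bx.
  have gxy0 : `[g x - g y] = 0.
    apply: c4P; rewrite -(ltr_pM2r w00); exact: le_lt_trans cc4.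
  have gE1 : g x = g y.
    by apply/eqP; rewrite -subr_eq0; apply/eqP; exact: (rnorm_eq0 ofRP gxy0).
  (* Equal values of [g] leave a difference of values of [f] of size at most [rho], below the gap
     [c2]; hence it is zero and [B] contains both points or neither. *)
  have fE : f x - f y = ofR rho * (visit B y - visit B x).
    have gE2 : f x + ofR rho * visit B x = f y + ofR rho * visit B y := gE1.
    by rewrite -[f x](addrK (ofR rho * visit B x)) gE2; ring.
  have fxy0 : `[f x - f y] = 0.
    apply: c2P; apply: lt_le_trans mc2; apply: le_lt_trans rhom.
    have -> : `[f x - f y] = rho * `[visit B y - visit B x].
      by rewrite fE (rnormZ ofRP (V := K)) rhoE.
    rewrite ler_piMr ?(ltW rho0)// /visit.
    have r1 : `[1 : K] = 1 by rewrite -(rmorph1 ofR) rnorm_ofR.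
    by case: `[< B y >]; case: `[< B x >];
      rewrite ?subrr ?sub0r ?subr0 ?rnormN// ?r1// rnorm0.
  have {}fxy0 : f x - f y = 0 by exact: (rnorm_eq0 ofRP fxy0).
  move: fE; rewrite fxy0 => /esym/eqP; rewrite mulf_eq0 fmorph_eq0 gt_eqF//=.
  rewrite subr_eq0 /visit (asboolT Bx); case: asboolP => //= _.
  by rewrite eq_sym oner_eq0.
Qed.

(** The order matters: marking moves every sum by at most [delta / 2] and so preserves the steering,
    whereas steering rewrites the values on a tower and could erase a mark. *)
Lemma step (f : X -> K) (delta : R) (z : Z) (B : set X) :
  simple_fun f -> 0 < delta -> measurable B ->
  exists g (eta : R), [/\ simple_fun g, 0 < eta <= delta / 2,
    (mu [set x | (delta < `[coding g x - coding f x])%R] <= delta%:E)%E,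
    ((4 * eta)%:E < mu [set x | (`[coding g x - z] <= delta)%R])%E &
    (forall x y, p (coding g x - coding g y) <= 4 * eta ->
      p (coding (visit B) x - coding (visit B) y) = 0) /\
    (forall x y, T x = T y -> `[coding g x - coding g y] <= 4 * eta ->
      B x -> B y)].
Proof.
move=> sf d0 mB; have d20 : 0 < delta / 2 by rewrite divr_gt0.
have d2d : delta / 2 <= delta by rewrite ler_pdivrMr// ler_peMr ?(ltW d0)// ler1n.
have [h [sh hf hz]] := steer z sf d20.
have [g [c [sg c0 gh gp gT]]] := mark sh d20 mB.
pose E := [set x | `[coding h x - z] <= delta / 2].
have mE : measurable E by exact: measurable_coding_le.
have fE : mu E \is a fin_num by exact: fin_num_measure.
pose r := fine (mu E).
have r0 : 0 < r by rewrite fine_gt0// hz ltey_eq fE.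
(* The three bounds give the halving of the tolerance, the decoding margin [4 * eta <= c], and room
   in measure for the points spoiled later. *)
pose eta := Num.min (delta / 2) (Num.min (c / 4) (r / 8)).
have eta0 : 0 < eta by rewrite !lt_min d20 !divr_gt0.
have etac : 4 * eta <= c.
  by rewrite mulrC -ler_pdivlMr// !ge_min lexx orbT.
have etar : 4 * eta < r.
  rewrite mulrC -ltr_pdivlMr//; apply: (@le_lt_trans _ _ (r / 8)).
    by rewrite !ge_min lexx !orbT.
  by rewrite ltr_pM2l// ltf_pV2 ?posrE// ltr_nat.
exists g, eta; split => //.
- by rewrite eta0 ge_min lexx.
- apply: (@le_trans _ _ (mu [set x | (delta / 2 < `[coding h x - coding f x])%R])).
    apply: le_measure; rewrite ?inE; try exact: measurable_coding_gt.
    move=> x /= dx; rewrite ltNge; apply: contraTN dx => hx.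
    rewrite -leNgt (splitr delta); apply: le_trans (rnorm_tri ofRP _ (coding h x) _) _.
    by apply: lerD.
  by apply: le_trans hf _; rewrite lee_fin.
- apply: (@lt_le_trans _ _ (mu E)); first by rewrite -(fineK fE) lte_fin.
  apply: le_measure; rewrite ?inE; try exact: measurable_coding_le.
  move=> x /= Ex; rewrite (splitr delta).
  by apply: le_trans (rnorm_tri ofRP _ (coding h x) _) _; apply: lerD.
- split => [x y h1|x y Txy h1]; first by apply: gp; exact: le_trans h1 etac.
  by apply: (gT x y Txy); exact: le_trans h1 etac.
Qed.

End coding.

(** * The limit of the construction *)

Lemma pushforward_probability d d' (X : measurableType d) (Y : measurableType d')
    (R : realType) (mu : probability X R) (Phi : X -> Y) :
  measurable_fun setT Phi ->
  exists nu : probability Y R, forall B, nu B = mu (Phi @^-1` B).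
Proof.
move=> mPhi; pose F : {mfun X >-> Y} := mfun_Sub (mem_set mPhi).
by exists (distribution mu F).
Qed.

Lemma measure_eq_mod0 d (X : measurableType d) (R : realType)
    (mu : probability X R) (Y S S' : set X) :
  measurable S -> measurable S' -> mu.-negligible (~` Y) ->
  (forall x, Y x -> S x <-> S' x) -> mu S = mu S'.
Proof.
move=> mS mS' nY SS'.
have h U V : measurable U -> measurable V ->
    (forall x, Y x -> U x -> V x) -> (mu U <= mu V)%E.
  move=> mU mV UV; have [N [mN N0 YN]] := nY.
  rewrite -[leRHS]adde0 -N0; apply: le_trans (measureU2 _ mV mN).
  apply: le_measure; rewrite ?inE//; first exact: measurableU.
  move=> x Ux; have [Yx|nYx] := pselect (Y x); first by left; exact: UV.
  by right; exact: YN.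
by apply/eqP; rewrite eq_le; apply/andP; split; apply: h => // x /SS' [].
Qed.

Lemma measurable_fun_open d (X : measurableType d) (Z : ptopologicalType)
    (Phi : X -> g_sigma_algebraType (@open Z)) :
  (forall U : set Z, open U -> measurable (Phi @^-1` U)) ->
  measurable_fun setT Phi.
Proof.
move=> mPhi; apply: (@measurability _ _ _ _ setT Phi (@open Z)) => //.
by move=> _ [U oU <-]; rewrite setTI; exact: mPhi.
Qed.

Section universality.
Context (R : realType) (K : numFieldType) (ofR : {rmorphism R -> K}).
Hypothesis ofRP : real_embedding ofR.
Context (Z : completeNormedModType K).
Local Notation "`[ x ]" := (rnorm ofR x) (format "`[ x ]").

(** Centres range over the dense set and radii over [1/(k+1)], through a code of pairs. The balls
    serve as a base for measurability and for Lusin's theorem, their centres as targets for full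
    support. *)
Lemma separable_balls : separable Z -> exists (c : nat -> Z) (r : nat -> R),
  (forall i, 0 < r i) /\ forall (z : Z) U, open U -> U z ->
    exists i, `[z - c i] < r i /\ forall y, `[y - c i] < r i -> U y.
Proof.
move=> [D [/countable_injP[f injf] dD]].
pose c i : Z := if (unpickle i : option (nat * nat)) is Some (n, _) then
  xget 0 [set z | D z /\ f z = n] else 0.
pose r i : R := if (unpickle i : option (nat * nat)) is Some (_, k) then k.+1%:R^-1 else 1.
exists c, r; split.
  by move=> i; rewrite /r; case: unpickle => [[? k]|//]; rewrite invr_gt0.
move=> z U /(rnorm_open ofRP) oU /oU[e e0 eU].
have e20 : 0 < e / 2 by rewrite divr_gt0.
have [k _ /(_ k (leqnn k)) /= ke] := near_infty_natSinv_lt (PosNum e20).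
have k0 : 0 < k.+1%:R^-1 :> R by rewrite invr_gt0.
have [y [zy Dy]] : [set y | `[y - z] < k.+1%:R^-1] `&` D !=set0.
  apply: dD; last exact: rnorm_ball_open.
  by exists z => /=; rewrite subrr rnorm0.
have [i iE] : exists i, unpickle i = Some (f y, k) :> option (nat * nat).
  by exists (pickle (f y, k)); exact: pickleK.
have ci : c i = y.
  rewrite /c iE; apply: xget_unique => // x [Dx fxy].
  by apply: injf => //; rewrite inE.
have ri : r i = k.+1%:R^-1 by rewrite /r iE.
exists i; rewrite ci ri; split; first by rewrite rnormBC.
move=> x xy; apply: eU; apply: le_lt_trans (rnorm_tri ofRP _ y _) _.
by rewrite (splitr e); apply: ltrD; apply: lt_trans ke.
Qed.

Variables (A : {linear Z -> Z}) (C : R).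
Hypothesis A_lip : forall x y, `[A x - A y] <= C * `[x - y].
Variable w : nat -> Z.
Hypothesis A_w0 : A (w 0%N) = 0.
Hypothesis A_wS : forall k, A (w k.+1) = w k.
Hypothesis w0_neq0 : w 0%N != 0.
Hypothesis w_sub : small_subsums ofR w.
Hypothesis w_dense : forall (z : Z) (e : R), 0 < e ->
  exists N (a : nat -> K), `[\sum_(0 <= k < N) a k *: w k - z] <= e.
Variable L : nat.
Local Notation p := (head_norm ofR w L).
Hypothesis w_head : exists k, p (w k) != 0.

Context d (X : measurableType d) (mu : probability X R) (T : X -> X).
Hypothesis ergT : ergodic mu T.
Hypothesis stdX : standard_lebesgue mu.
Let mpT : measure_preserving mu T := ergT.1.
Local Notation coding := (coding ofR w T).

Lemma coding_shift (f : X -> K) x : simple_fun f -> coding f (T x) = A (coding f x).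
Proof.
move=> sf; rewrite [RHS](wsum_shift ofRP w_sub A_lip)//; last exact: simple_orbit.
by congr wsum; apply/funext => k /=; rewrite -iterS iterSr.
Qed.

(* In a set with return times larger than [2 * L] at most one coefficient of the
   head of [coding (visit B) x] is nonzero, so the vanishing of [p] along the
   orbit of [x] reveals when the orbit visits [B]; the first visible
   coefficient is the least [k] with [p (w k) != 0]. *)
Lemma head_norm_decode (B : set X) (k0 : nat) : measurable B ->
  (forall x i, (i < L + L)%N -> B x -> ~ B (iter i.+1 T x)) ->
  p (w k0) != 0 -> (forall k, p (w k) != 0 -> (k0 <= k)%N) ->
  forall x, B (iter k0 T x) <->
    p (coding (visit K B) x) != 0 /\
    forall j, (0 < j <= L)%N -> p (coding (visit K B) (iter j T x)) = 0.
Proof.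
move=> mB Bsp pk0 k0min; have sB := simple_visit K mB.
have wL k : p (w k) != 0 -> (k < L)%N.
  by rewrite ltnNge; apply: contra => Lk; apply/eqP/head_norm_span/tail_span_w.
have pE x : p (coding (visit K B) x) =
    p (partial w (fun k => visit K B (iter k T x)) L).
  by apply: head_norm_congr => //; apply: head_norm_wsum => //; exact: simple_orbit.
(* Position [m < L] seen after [j <= L] steps is time [m + j < L + L], whence the length of the
   excluded return times. *)
have uniq_visit x m n : (m < L + L)%N -> (n < L + L)%N ->
    B (iter m T x) -> B (iter n T x) -> m = n.
  wlog mn : m n / (m <= n)%N.
    move=> H; case: (leqP m n) => [|/ltnW]; first exact: H.
    by move=> nm mL nL Bm Bn; apply/esym; exact: H.
  move=> mL nL Bm Bn; move: mn; rewrite leq_eqVlt => /predU1P[//|mn].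
  have := @Bsp _ (n - m).-1 _ Bm; rewrite prednK ?subn_gt0// -iterD subnK ?(ltnW mn)//.
  by move=> H; exfalso; apply: H Bn; lia.
have one_visit x m : (m < L)%N -> B (iter m T x) -> p (coding (visit K B) x) = p (w m).
  move=> mL Bm; rewrite pE; congr p; rewrite /partial (bigD1_seq m)/= ?iota_uniq//.
    rewrite {1}/visit asboolT// scale1r big1_seq ?addr0// => k.
    rewrite mem_index_iota => /andP[km /andP[_ kL]].
    rewrite /visit; case: asboolP => [Bk|_]; last by rewrite scale0r.
    by move: km; rewrite (uniq_visit x k m) ?eqxx//; lia.
  by rewrite mem_index_iota.
have no_visit x : (forall m, (m < L)%N -> ~ B (iter m T x)) ->
    p (coding (visit K B) x) = 0.
  move=> nB; rewrite pE /partial big1_seq.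
    by apply: head_norm_span => //; exact: tail_span0.
  move=> k; rewrite mem_index_iota => /andP[_ kL].
  by rewrite /visit asboolF ?scale0r//; exact: nB.
have k0L := wL _ pk0.
move=> x; split.
  move=> Bk0; split; first by rewrite (one_visit x k0).
  move=> j /andP[j0 jL].
  have [[m mL Bm]|nB] :=
      pselect (exists2 m, (m < L)%N & B (iter m T (iter j T x))); last first.
    by apply: no_visit => m mL Bm; apply: nB; exists m.
  rewrite (one_visit _ m)//; move: Bm; rewrite -iterD => Bm.
  (* The visit seen after [j] steps is the same one, now at position [m = k0 - j], where [p (w m)]
     is zero by minimality of [k0]. *)
  have mjk : (m + j = k0)%N by apply: (uniq_visit x) => //; lia.
  by apply/eqP; apply: contraPT mjk => /k0min; lia.
move=> [px pj].
have [[m mL Bm]|nB] := pselect (exists2 m, (m < L)%N & B (iter m T x)); last first.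
  by move: px; rewrite no_visit ?eqxx// => m mL Bm; apply: nB; exists m.
have : p (w m) != 0 by rewrite -(one_visit x m).
move=> /k0min; rewrite leq_eqVlt => /predU1P[->//|k0m].
(* A visit at a position [m] beyond [k0] would be seen at position [k0] after [m - k0] steps, where
   [p] is nonzero. *)
have := pj (m - k0)%N; rewrite (one_visit _ k0)//; last first.
  by rewrite -iterD subnKC// ltnW.
by move=> H; exfalso; move/eqP: pk0; apply; apply: H; lia.
Qed.

(** [delta n.+1] is both the tolerance fixed at the end of stage [n] and the accuracy demanded of
    stage [n.+1]. *)
Lemma coding_sequence (zs : nat -> Z) (Bs : nat -> set X) :
  (forall n, measurable (Bs n)) ->
  exists (f : nat -> X -> K) (delta : nat -> R), delta 0%N = 1 /\ forall n,
  [/\ simple_fun (f n), 0 < delta n /\ delta n.+1 <= delta n / 2,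
    (mu [set x | (delta n < `[coding (f n.+1) x - coding (f n) x])%R]
      <= (delta n)%:E)%E,
    ((4 * delta n.+1)%:E <
      mu [set x | (`[coding (f n.+1) x - zs n] <= delta n)%R])%E &
    (forall x y, p (coding (f n.+1) x - coding (f n.+1) y) <= 4 * delta n.+1 ->
      p (coding (visit K (Bs n)) x - coding (visit K (Bs n)) y) = 0) /\
    (forall x y, T x = T y ->
      `[coding (f n.+1) x - coding (f n.+1) y] <= 4 * delta n.+1 ->
      Bs n x -> Bs n y)].
Proof.
move=> mBs.
pose ok (s : (X -> K) * R) := simple_fun s.1 /\ 0 < s.2.
pose next n (s s' : (X -> K) * R) := [/\ ok s', s'.2 <= s.2 / 2,
    (mu [set x | (s.2 < `[coding s'.1 x - coding s.1 x])%R] <= (s.2)%:E)%E,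
    ((4 * s'.2)%:E < mu [set x | (`[coding s'.1 x - zs n] <= s.2)%R])%E &
    (forall x y, p (coding s'.1 x - coding s'.1 y) <= 4 * s'.2 ->
      p (coding (visit K (Bs n)) x - coding (visit K (Bs n)) y) = 0) /\
    (forall x y, T x = T y -> `[coding s'.1 x - coding s'.1 y] <= 4 * s'.2 ->
      Bs n x -> Bs n y)].
have /choice[F FP] (ns : nat * ((X -> K) * R)) :
    exists s', ok ns.2 -> next ns.1 ns.2 s'.
  case: ns => n s; have [[sf d0]|nok] := pselect (ok s); last by exists s.
  have [g [eta [sg /andP[e0 es] h1 h2 h3]]] :=
    step ofRP w_sub ergT stdX w_dense w0_neq0 L (zs n) sf d0 (mBs n).
  by exists (g, eta).
pose s := fix s n := if n is m.+1 then F (m, s m) else (fun=> 0 : K, 1 : R).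
have sok n : ok (s n).
  elim: n => [|n IHn]; first by split => //; exact: simple_cst.
  by have [] := FP (n, s n) IHn.
exists (fun n => (s n).1), (fun n => (s n).2); split => // n.
have [okn h1 h2 h3 h4] := FP (n, s n) (sok n).
by have [sfn dn] := sok n; split.
Qed.

(** * Almost everywhere convergence of the codings *)

Section limit.
Variables (f : nat -> X -> K) (delta : nat -> R).
Hypothesis sf : forall n, simple_fun (f n).
Hypothesis delta0 : delta 0%N = 1.
Hypothesis delta_gt0 : forall n, 0 < delta n.
Hypothesis delta_half : forall n, delta n.+1 <= delta n / 2.

Definition jump n : set X :=
  [set x | delta n < `[coding (f n.+1) x - coding (f n) x]].
Hypothesis mu_jump : forall n, (mu (jump n) <= (delta n)%:E)%E.

Definition settled : set X :=
  [set x | exists J, forall n, (J <= n)%N -> ~ jump n x].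

(** The default 0 off [settled] makes the map measurable on the whole space. *)
Definition limit_coding (x : X) : Z :=
  xget 0 [set l | settled x /\ rlim ofR (fun n => coding (f n) x) l].

Lemma measurable_jump n : measurable (jump n).
Proof. exact: (measurable_coding_gt ofRP w_sub ergT). Qed.

Lemma delta_geometric n k : delta (n + k) <= 2 * delta n / (2 ^ k.+1)%:R.
Proof.
elim: k => [|k IHk]; first by rewrite addn0 expn1 mulrAC divff ?mul1r// pnatr_eq0.
rewrite addnS; apply: le_trans (delta_half _) _.
by rewrite expnSr natrM invfM mulrA ler_pM2r.
Qed.

Lemma mu_jump_tail n : (mu (\bigcup_k jump (n + k)) <= (2 * delta n)%:E)%E.
Proof.
have mj k : measurable (jump (n + k)) by exact: measurable_jump.
have mU : measurable (\bigcup_k jump (n + k)) by exact: bigcupT_measurable.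
have h := measure_sigma_subadditive mu mj mU (@subset_refl _ _).
apply: le_trans h _.
have d0 : 0 <= 2 * delta n by rewrite mulr_ge0// ltW.
apply: le_trans (epsilon_trick0 xpredT d0).
apply: lee_nneseries => // k _.
by apply: le_trans (mu_jump _) _; rewrite lee_fin delta_geometric.
Qed.

Lemma delta_small (e : R) : 0 < e -> exists n, forall m, (n <= m)%N -> 2 * delta m < e.
Proof.
move=> e0; have e4 : 0 < e / 4 by rewrite divr_gt0.
have [n _ nP] := near_infty_natSinv_lt (PosNum e4).
exists n => m nm; have /= h := nP m nm.
have := delta_geometric 0 m; rewrite add0n delta0 mulr1 => dm.
apply: (@le_lt_trans _ _ (2 * (2 * m.+1%:R^-1))).
  rewrite ler_pM2l//; apply: le_trans dm _; rewrite ler_pM2l//.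
  rewrite lef_pV2 ?posrE ?ltr0n ?expn_gt0// ler_nat.
  by apply: ltnW; exact: ltn_expl.
by rewrite mulrA -natrM mulrC -ltr_pdivlMr.
Qed.

Lemma measurable_settled : measurable settled.
Proof.
rewrite (_ : settled = \bigcup_J \bigcap_(n in [set n | (J <= n)%N]) ~` jump n).
  apply: bigcupT_measurable => J; apply: bigcap_measurableType => n _.
  by apply: measurableC; exact: measurable_jump.
by apply/seteqP; split => [x [J Jx]|x [J _ Jx]]; exists J.
Qed.

(** Borel-Cantelli: the measures of the jumps are dominated by a geometric series. *)
Lemma negligible_unsettled : mu.-negligible (~` settled).
Proof.
have mj k : measurable (jump k) by exact: measurable_jump.
apply: (negligibleS (A := lim_sup_set jump)).
  move=> x nx n _ /=; apply: contrapT => nj; apply: nx; exists n => m nm jm.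
  by apply: nj; exists m.
apply/negligibleP.
  by apply: bigcapT_measurable => n; apply: bigcup_measurable.
apply: lim_sup_set_cvg0 => //.
apply: (@le_lt_trans _ _ (2%:E)%E); last exact: ltry.
apply: le_trans (epsilon_trick0 xpredT (ler0n R 2)).
apply: lee_nneseries => // k _.
apply: le_trans (mu_jump _) _; rewrite lee_fin.
by have := delta_geometric 0 k; rewrite add0n delta0 mulr1.
Qed.

Lemma coding_settled x n m : (forall k, (n <= k)%N -> ~ jump k x) -> (n <= m)%N ->
  `[coding (f m) x - coding (f n) x] <= 2 * delta n.
Proof.
move=> nj nm; rewrite -(subnKC nm).
(* Subtracting [2 * delta (n + k)] makes the induction close, since [2 * delta (n + k).+1] is at
   most [delta (n + k)]. *)
suff h k : `[coding (f (n + k)) x - coding (f n) x] <= 2 * delta n - 2 * delta (n + k).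
  by apply: le_trans (h _) _; rewrite gerBl mulr_ge0// ltW.
elim: k => [|k IHk]; first by rewrite addn0 !subrr rnorm0.
rewrite addnS; apply: le_trans (rnorm_tri ofRP _ (coding (f (n + k)) x) _) _.
have h1 : `[coding (f (n + k).+1) x - coding (f (n + k)) x] <= delta (n + k).
  by rewrite leNgt; apply/negP; exact: nj (leq_addr _ _).
have h2 := delta_half (n + k).
apply: le_trans (lerD h1 IHk) _; lra.
Qed.

Lemma limit_codingP x : settled x ->
  rlim ofR (fun n => coding (f n) x) (limit_coding x).
Proof.
move=> sx; rewrite /limit_coding; case: xgetP => [l _ []//|nl].
have [|l lP] := @rlim_complete _ _ _ ofRP Z (fun n => coding (f n) x); last first.
  by have := nl l; case.
have [J JP] := sx; move=> e e0; have [n nP] := delta_small e0.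
exists (maxn J n) => m nm.
apply: le_trans (coding_settled _ nm) _.
  by move=> k; rewrite geq_max => /andP[/JP].
by apply/ltW/nP; exact: leq_maxr.
Qed.

Lemma limit_coding_near x n : (forall k, (n <= k)%N -> ~ jump k x) ->
  `[limit_coding x - coding (f n) x] <= 2 * delta n.
Proof.
move=> nj; have sx : settled x by exists n.
apply: (rlim_le ofRP (n := n) (limit_codingP sx)) => m nm.
exact: coding_settled.
Qed.

Lemma limit_coding_eq x y : settled x -> settled y ->
  limit_coding x = limit_coding y ->
  exists J, forall n, (J <= n)%N ->
    `[coding (f n) x - coding (f n) y] <= 4 * delta n.
Proof.
move=> [J Jx] [J' Jy] xy; exists (maxn J J') => n.
rewrite geq_max => /andP[Jn J'n].
have hx : `[limit_coding x - coding (f n) x] <= 2 * delta n.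
  by apply: limit_coding_near => k nk; apply: Jx; exact: leq_trans nk.
have hy : `[limit_coding x - coding (f n) y] <= 2 * delta n.
  by rewrite xy; apply: limit_coding_near => k nk; apply: Jy; exact: leq_trans nk.
apply: le_trans (rnorm_tri ofRP _ (limit_coding x) _) _.
rewrite rnormBC//; apply: le_trans (lerD hx hy) _; lra.
Qed.

Lemma limit_coding_shift x : settled x -> settled (T x) ->
  limit_coding (T x) = A (limit_coding x).
Proof.
move=> sx sTx; apply: (rlim_unique ofRP (limit_codingP sTx)).
have := rlim_lipschitz ofRP A_lip (limit_codingP sx).
by congr (rlim _ _ _); apply/funext => n /=; rewrite coding_shift.
Qed.

Lemma measurable_limit_dist (c : Z) :
  measurable_fun setT (fun x => `[limit_coding x - c]).
Proof.
have sG := simple_indicator measurable_settled.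
pose ind (b : bool) : R := b%:R.
(* Off [settled] the approximants are constantly the norm of [c], its distance to the default value
   0. *)
apply: (@measurable_fun_cvg _ _ _ _ (fun m x =>
  `[coding (f m) x - c] * ind `[< settled x >] +
  `[c] * ind (~~ `[< settled x >]))).
  move=> m; apply: measurable_funD; apply: measurable_funM.
  - exact: (measurable_coding_dist ofRP w_sub ergT).
  - by apply: simple_measurable; exact: (simple_comp ind).
  - exact: measurable_cst.
  - by apply: simple_measurable; exact: (simple_comp (fun b => ind (~~ b))).
move=> x _; rewrite /ind; case: asboolP => sx /=.
  under eq_fun do rewrite mulr1 mulr0 addr0.
  by apply: rlim_norm => //; exact: limit_codingP.
under eq_fun do rewrite mulr1 mulr0 add0r.
have -> : limit_coding x = 0.
  by rewrite /limit_coding xgetPN// => l [].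
by rewrite sub0r rnormN//; exact: cvg_cst.
Qed.

Lemma measurable_limit_coding : separable Z ->
  measurable_fun setT (limit_coding : X -> g_sigma_algebraType (@open Z)).
Proof.
move=> /separable_balls[c [r [r0 cr]]].
apply: measurable_fun_open => U oU.
rewrite (_ : _ @^-1` U = \bigcup_(i in [set i | forall y, `[y - c i] < r i -> U y])
    [set x | `[limit_coding x - c i] < r i]).
  apply: bigcup_measurable => i _.
  have := measurable_limit_dist (c i) measurableT.
  move=> /(_ `]-oo, (r i)[%classic (measurable_itv _)); rewrite setTI.
  by congr (measurable _); apply/seteqP; split => x /=; rewrite in_itv.
apply/seteqP; split => [x Ux|x [i Ui xi]]; last exact: Ui.
by have [i [xi Ui]] := cr _ _ oU Ux; exists i.
Qed.

End limit.

(** The schedule of the construction: stage [n] treats the target and the separating set of number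
    [logn 2 n], so each is treated at arbitrarily late stages. *)
Lemma logn2_cofinal i J : exists2 n, (J <= n)%N & logn 2 n = i.
Proof.
exists (2 ^ i * (J.*2.+1))%N.
  apply: leq_trans (_ : 1 * J.*2.+1 <= _)%N; first by rewrite mul1n -addnn; lia.
  by rewrite leq_mul2r expn_gt0 orbT.
rewrite lognM ?expn_gt0// pfactorK// logn_coprime ?addn0//.
by rewrite coprime2n /= odd_double.
Qed.

Lemma universal_model : separable Z ->
  exists nu : probability (g_sigma_algebraType (@open Z)) R,
    [/\ measure_preserving nu A, full_support nu & isomorphic_systems mu T nu A].
Proof.
move=> sepZ.
have [c [r [r0 cr]]] := separable_balls sepZ.
have [Bf [Y [mBf Bsp nY BY]]] := sparse_family mpT ergT stdX (L + L).
have [f [delta [delta0 fd]]] := coding_sequence (fun n => c (logn 2 n))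
  (fun n => mBf (logn 2 n)).
have sf n : simple_fun (f n) by have [] := fd n.
have d0 n : 0 < delta n by have [_ []] := fd n.
have dhalf n : delta n.+1 <= delta n / 2 by have [_ []] := fd n.
have mujump n : (mu (jump f delta n) <= (delta n)%:E)%E by have [] := fd n.
have [Phi PhiE] : exists Phi, Phi = limit_coding f delta by eexists.
have mPhi : measurable_fun setT (Phi : X -> g_sigma_algebraType (@open Z)).
  by rewrite PhiE; exact: measurable_limit_coding.
have [nu nuE] := pushforward_probability mu mPhi.
(* Asking for a good forward orbit, and not just a good point, makes the domain invariant under
   [T]. *)
pose X0 := [set x | forall n, (settled f delta `&` Y) (iter n T x)].
have nX0 : mu.-negligible (~` X0).
  apply: negligible_forward_core => //; rewrite setCI; apply: negligibleU => //.
  exact: negligible_unsettled.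
have TX0 x : X0 x -> X0 (T x) by move=> Xx n; rewrite -iterSr; exact: Xx.
have itX0 x n : X0 x -> X0 (iter n T x) by elim: n => //= n IHn /IHn; exact: TX0.
have X0s x : X0 x -> settled f delta x by move=> /(_ 0%N)[].
have X0Y x : X0 x -> Y x by move=> /(_ 0%N)[].
have PhiT x : X0 x -> Phi (T x) = A (Phi x).
  by move=> Xx; rewrite PhiE limit_coding_shift//; apply: X0s => //; exact: TX0.
have Phi_iter x y n : X0 x -> X0 y -> Phi x = Phi y ->
    Phi (iter n T x) = Phi (iter n T y).
  move=> Xx Xy xy; elim: n => //= n IHn.
  by rewrite !PhiT ?IHn//; exact: itX0.
have close x y i : X0 x -> X0 y -> Phi x = Phi y -> exists2 n, logn 2 n = i &
    `[coding (f n.+1) x - coding (f n.+1) y] <= 4 * delta n.+1.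
  rewrite PhiE => Xx Xy /(limit_coding_eq delta0 d0 dhalf (X0s _ Xx) (X0s _ Xy))[J JP].
  have [n Jn ni] := logn2_cofinal i J.
  by exists n => //; apply: JP; exact: leqW.
have separate x y : Y x -> Y y -> (forall i, Bf i x -> Bf i y) -> x = y.
  move=> Yx Yy xy; apply: contrapT => nxy.
  have [i [Bx By _]] := BY x y 1 ltr01 Yx Yy.
  by apply: By (xy _ Bx) => yx; apply: nxy.
have pB x y i : X0 x -> X0 y -> Phi x = Phi y ->
    p (coding (visit K (Bf i)) x) = p (coding (visit K (Bf i)) y).
  move=> Xx Xy /(close _ _ i Xx Xy)[n ni h].
  apply: head_norm_congr => //; have [_ _ _ _ [+ _]] := fd n; rewrite ni; apply.
  exact: le_trans (head_norm_ler _ _ _ _) h.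
have injPhi : set_inj X0 Phi.
  move=> x y; rewrite !inE => Xx Xy xy.
  have exk : exists k, p (w k) != 0 := w_head.
  have [k0 pk0 k0min] := ex_minnP exk.
  have decode := head_norm_decode (mBf _) (Bsp _) pk0 k0min.
  (* The test in [decode] involves only [p] along the forward orbit, and equal sums make these
     numbers equal. *)
  have base : iter k0 T x = iter k0 T y.
    apply: separate; [exact/X0Y/itX0|exact/X0Y/itX0|] => i.
    move=> /decode[px pj]; apply/decode; split; first by rewrite -(pB x y).
    move=> j jL; rewrite -(pB (iter j T x)) ?pj//; try exact: itX0.
    exact: Phi_iter.
  (* Descent from [k0]: once [T u = T v], the last clause of [coding_sequence] transfers membership
     in every [Bf i] from [u] to [v]. *)
  elim: k0 base {pk0 k0min decode} => [//|k IHk] TT; apply: IHk.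
  have desc u v : X0 u -> X0 v -> Phi u = Phi v -> T u = T v ->
      forall i, Bf i u -> Bf i v.
    move=> Xu Xv uv Tuv i; have [n ni h] := close u v i Xu Xv uv.
    by have [_ _ _ _ [_ /(_ u v Tuv h)]] := fd n; rewrite ni.
  apply: separate; [exact/X0Y/itX0|exact/X0Y/itX0|].
  by apply: desc => //; [exact: itX0|exact: itX0|exact: Phi_iter].
have hZ : hausdorff_space Z by exact: norm_hausdorff.
have mA : measurable_fun setT
    (A : g_sigma_algebraType (@open Z) -> g_sigma_algebraType (@open Z)).
  apply: measurable_fun_open => U oU; apply: sub_sigma_algebra.
  apply/(rnorm_open ofRP) => x /= /((rnorm_open ofRP _).1 oU)[e e0 eU].
  have C0 : 0 < `|C| + 1 by rewrite ltr_wpDl.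
  exists (e / (`|C| + 1)); first by rewrite divr_gt0.
  move=> y; rewrite ltr_pdivlMr// => h; apply: eU.
  apply: le_lt_trans (A_lip _ _) _; apply: le_lt_trans h.
  rewrite [leRHS]mulrC ler_wpM2r ?rnorm_ge0//.
  by apply: le_trans (ler_norm _) _; rewrite lerDl.
exists nu; split.
- split; first exact: mA.
  move=> B mB; rewrite !nuE.
  have mPB := measurable_preimage mPhi mB.
  have TPB : mu (T @^-1` (Phi @^-1` B)) = mu (Phi @^-1` B) by exact: mpT.2.
  rewrite -TPB; apply: (measure_eq_mod0 (Y := X0)) => //.
  + exact: (measurable_preimage mPhi (measurable_preimage mA mB)).
  + exact: (measurable_preimage_iter mpT 1).
  + by move=> x Xx; rewrite /preimage/= PhiT.
- move=> U oU [u Uu].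
  have [i [ui iU]] := cr _ _ oU Uu.
  have Uc : U (c i) by apply: iU; rewrite subrr rnorm0.
  have [e e0 eU] := (rnorm_open ofRP U).1 oU _ Uc.
  have [n0 n0P] := delta_small delta0 dhalf e0.
  have [n n0n ni] := logn2_cofinal i n0.
  have [_ _ _ hP _] := fd n; rewrite ni in hP.
  set P := [set x | _] in hP.
  have mP : measurable P by exact: (measurable_coding_le ofRP w_sub ergT).
  pose V := \bigcup_k jump f delta (n.+1 + k).
  have mV : measurable V.
    by apply: bigcupT_measurable => k; exact: measurable_jump.
  have muV : (mu V <= (2 * delta n.+1)%:E)%E by exact: mu_jump_tail.
  have mU : measurable (Phi @^-1` U).
    by apply: (measurable_preimage mPhi); exact: sub_sigma_algebra.
  (* Discarding the points that jump later costs at most [2 * delta n.+1], less than the measure of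
     [P]; the others end within [delta n + 2 * delta n.+1 <= 2 * delta n < e] of the centre. *)
  rewrite nuE; apply: (@lt_le_trans _ _ (mu (P `\` V))); last first.
    apply: le_measure; rewrite ?inE//; first exact: measurableD.
    move=> x [Px nVx]; apply: eU.
    have nj k : (n < k)%N -> ~ jump f delta k x.
      by move=> nk jk; apply: nVx; exists (k - n.+1)%N => //; rewrite subnKC.
    apply: le_lt_trans (n0P n n0n).
    apply: le_trans (rnorm_tri ofRP _ (coding (f n.+1) x) _) _.
    have h := limit_coding_near delta0 d0 dhalf nj; rewrite -PhiE in h.
    apply: le_trans (lerD h Px) _; have := dhalf n; lra.
  rewrite lt0e measure_ge0 andbT; apply/eqP => PV0.
  have : (mu P <= mu (P `\` V) + mu V)%E.
    apply: le_trans (measureU2 _ _ _) => //; last exact: measurableD.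
    apply: le_measure; rewrite ?inE//.
      by apply: measurableU => //; exact: measurableD.
    by move=> x Px; have [Vx|nVx] := pselect (V x); [right|left].
  rewrite PV0 add0e => /le_trans -/(_ _ muV); apply/negP; rewrite -ltNge.
  apply: le_lt_trans hP; rewrite lee_fin ler_pM2r// ler_nat//.
- exists X0, (Phi @` X0), Phi; split => //.
  + apply: (injective_mod0_isomorphism stdX (O := fun i => [set y | `[y - c i] < r i])) => //.
    * by move=> i; exact: rnorm_ball_open.
  + by move=> _ [x Xx <-]; exists (T x); [exact: TX0|exact: PhiT].
Qed.

End universality.

(** * Unconditional convergence and two-sided sequences *)

Section rearrangement.
Context (R : realType) (K : numFieldType) (ofR : {rmorphism R -> K}).
Hypothesis ofRP : real_embedding ofR.
Context (Z : completeNormedModType K) (w : nat -> Z).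
Local Notation "`[ x ]" := (rnorm ofR x) (format "`[ x ]").

Section blocks.
Variables (P : nat -> pred nat) (lo hi : nat -> nat).
Hypothesis lohi : forall c, (c <= lo c < hi c)%N.

(* Listing the indices that satisfy [P c] consecutively turns the subsum over
   them into a difference of partial sums. *)
Definition block c : seq nat :=
  iota c (lo c - c) ++ (seq.filter (P c) (iota (lo c) (hi c - lo c)) ++
  seq.filter (predC (P c)) (iota (lo c) (hi c - lo c))).

Fixpoint cut i : nat := if i is j.+1 then hi (cut j) else 0.

Fixpoint blocks i : seq nat := if i is j.+1 then blocks j ++ block (cut j) else [::].

Lemma perm_blocks i : perm_eq (blocks i) (iota 0 (cut i)).
Proof.
elim: i => //= i IHi; have /andP[cl lh] := lohi (cut i).
have -> : hi (cut i) = (cut i + (hi (cut i) - cut i))%N.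
  by rewrite subnKC// ltnW// (leq_ltn_trans cl lh).
rewrite iotaD add0n perm_cat//.
have -> : (hi (cut i) - cut i)%N = (lo (cut i) - cut i + (hi (cut i) - lo (cut i)))%N.
  by move: cl lh; lia.
by rewrite iotaD subnKC// perm_cat2l perm_filterC.
Qed.

Lemma size_blocks i : size (blocks i) = cut i.
Proof. by rewrite (perm_size (perm_blocks i)) size_iota. Qed.

Lemma uniq_blocks i : uniq (blocks i).
Proof. by rewrite (perm_uniq (perm_blocks i)) iota_uniq. Qed.

Lemma mem_blocks i v : (v \in blocks i) = (v < cut i)%N.
Proof. by rewrite (perm_mem (perm_blocks i)) mem_iota. Qed.

Lemma leq_cut i : (i <= cut i)%N.
Proof.
elim: i => //= i IHi; have /andP[cl lh] := lohi (cut i).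
exact: leq_ltn_trans IHi (leq_ltn_trans cl lh).
Qed.

Lemma blocks_prefix i j : (i <= j)%N -> exists t, blocks j = blocks i ++ t.
Proof.
move=> /subnKC <-; elim: (j - i)%N => [|k [t tE]].
  by exists [::]; rewrite addn0 cats0.
by rewrite addnS /= tE; eexists; rewrite -catA.
Qed.

Definition rearrange k := nth 0%N (blocks k.+1) k.

Lemma rearrangeE i k : (k < cut i)%N -> rearrange k = nth 0%N (blocks i) k.
Proof.
move=> ki; rewrite /rearrange; have [ik|ki'] := leqP i k.+1.
  by have [t ->] := blocks_prefix ik; rewrite nth_cat size_blocks ki.
have [t ->] := blocks_prefix (ltnW ki'); rewrite nth_cat size_blocks.
by rewrite leq_cut.
Qed.

(** Each stage of the list permutes an initial segment of the natural numbers, and these segments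
    exhaust them; later stages do not alter earlier positions. *)
Lemma rearrange_bij : bijective rearrange.
Proof.
exists (fun v => index v (blocks v.+1)) => k.
  have h i : (rearrange k < cut i)%N -> (k < cut i)%N ->
      index (rearrange k) (blocks i) = k.
    by move=> _ ki; rewrite (rearrangeE ki) index_uniq ?uniq_blocks ?size_blocks.
  set v := rearrange k.
  have vv : v \in blocks v.+1 by rewrite mem_blocks leq_cut.
  have [t tE] := blocks_prefix (leq_maxl v.+1 k.+1).
  transitivity (index v (blocks (maxn v.+1 k.+1))).
    by rewrite tE [RHS]index_cat vv.
  apply: h; apply: leq_trans (leq_cut _); first exact: leq_maxl.
  exact: leq_maxr.
have kk : k \in blocks k.+1 by rewrite mem_blocks leq_cut.
rewrite (@rearrangeE k.+1); first by rewrite nth_index.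
by rewrite -size_blocks index_mem.
Qed.

Lemma rearrange_sum i N : (N <= cut i)%N ->
  \sum_(0 <= j < N) w (rearrange j) = \sum_(x <- take N (blocks i)) w x.
Proof.
move=> Ni; rewrite [RHS](big_nth 0%N) size_takel ?size_blocks//.
apply: eq_big_nat => j /andP[_ jN].
by rewrite nth_take// (@rearrangeE i)//; exact: leq_trans Ni.
Qed.

Lemma rearrange_block i : exists N N',
  [/\ (i <= N)%N, (N <= N')%N &
  \sum_(0 <= j < N') w (rearrange j) - \sum_(0 <= j < N) w (rearrange j) =
  \sum_(lo (cut i) <= k < hi (cut i) | P (cut i) k) w k].
Proof.
have /andP[cl lh] := lohi (cut i).
set c := cut i in cl lh *.
pose pre := blocks i ++ iota c (lo c - c).
pose mid := seq.filter (P c) (iota (lo c) (hi c - lo c)).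
pose post := seq.filter (predC (P c)) (iota (lo c) (hi c - lo c)).
have bE : blocks i.+1 = pre ++ mid ++ post by rewrite /= /block !catA.
have sE : (size pre + (size mid + size post))%N = cut i.+1.
  by rewrite -size_blocks bE !size_cat.
exists (size pre), (size pre + size mid)%N; split.
- by rewrite size_cat size_blocks (leq_trans (leq_cut i))// leq_addr.
- exact: leq_addr.
rewrite !(@rearrange_sum i.+1) -?sE ?leq_add2l ?leq_addr//.
rewrite bE [take (size pre) _]take_size_cat// catA.
rewrite take_size_cat ?size_cat// big_cat/=.
by rewrite addrAC subrr add0r big_filter.
Qed.

End blocks.

(** If subsums larger than [e] occurred beyond every index, a rearrangement listing the indices of
    infinitely many of them consecutively would have partial sums that are not Cauchy. *)
Lemma small_subsums_rearrangement :
  (forall s : nat -> nat, bijective s ->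
    exists l, rlim ofR (fun m => \sum_(0 <= j < m) w (s j)) l) ->
  small_subsums ofR w.
Proof.
move=> cvgw e e0; apply: contrapT => /forallNP nsmall.
have /choice[F FP] n : exists t : pred nat * (nat * nat),
    (n <= t.2.1)%N /\ e < `[\sum_(t.2.1 <= k < t.2.2 | t.1 k) w k].
  have /existsNP[P /existsNP[n' /existsNP[m]]] := nsmall n.
  move=> /not_implyP[nn' h]; exists (P, (n', m)); split => //=.
  by rewrite ltNge; apply/negP.
pose P c := (F c).1; pose lo c := (F c).2.1; pose hi c := (F c).2.2.
have lohi c : (c <= lo c < hi c)%N.
  have [-> h] := FP c; rewrite ltnNge; apply/negP => hl; move: h.
  by rewrite big_geq// rnorm0// ltNge (ltW e0).
have [l lP] := cvgw _ (rearrange_bij P lohi).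
have [n nP] := lP _ (divr_gt0 e0 (ltr0n R 2)).
have [N [N' [nN NN' NE]]] := rearrange_block P lohi n.
have [_] := FP (cut hi n); rewrite -[X in _ < `[X]]NE; apply/negP; rewrite -leNgt.
apply: le_trans (rnorm_tri ofRP _ l _) _; rewrite (splitr e).
apply: lerD; first exact: nP (leq_trans nN NN').
by rewrite rnormBC//; exact: nP.
Qed.

End rearrangement.

(** * From the two-sided sequence to a backward orbit *)

Section two_sided.
Context (R : realType) (K : numFieldType) (ofR : {rmorphism R -> K}).
Hypothesis ofRP : real_embedding ofR.
Context (Z : completeNormedModType K).
Local Notation "`[ x ]" := (rnorm ofR x) (format "`[ x ]").

Lemma bounded_lipschitz (A : {linear Z -> Z}) : bounded_operator A ->
  exists C : R, forall x y, `[A x - A y] <= C * `[x - y].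
Proof.
move=> [M MP]; exists `[M] => x y; rewrite -linearB -ofRP.1 rmorphM !rnormE//.
apply: le_trans (MP _) _.
have h : 0 <= M * `|x - y| by exact: le_trans (MP _).
by rewrite -(ger0_norm h) normrM normr_id.
Qed.

Lemma closed_spanP (S : set Z) (y : Z) : closed_span S y <->
  forall e : R, 0 < e -> exists2 v, linear_span S v & `[v - y] < e.
Proof.
split => [Sy e e0|H B].
  have /Sy[v [Sv vy]] : nbhs y [set v | `[v - y] < e].
    by apply/(rnorm_nbhs ofRP); exists e.
  by exists v.
move=> /(rnorm_nbhs ofRP)[e e0 eB]; have [v Sv vy] := H e e0.
by exists v; split => //; exact: eB.
Qed.

Lemma linear_span_tail (w : nat -> Z) (L : nat) (S : set Z) :
  S `<=` tail_span w L -> linear_span S `<=` tail_span w L.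
Proof.
move=> SW _ [n [a [v [Sv ->]]]].
elim/big_ind: _ => [||i _]; [exact: tail_span0|exact: tail_spanD|].
exact/tail_spanZ/SW.
Qed.

Lemma tail_linear_span (w : nat -> Z) (L : nat) (S : set Z) :
  (forall k, (L <= k)%N -> S (w k)) -> tail_span w L `<=` linear_span S.
Proof.
move=> Sw _ [N [a ->]]; exists (N - L)%N, (fun i => a (i + L)%N), (fun i => w (i + L)%N).
split; first by move=> i; apply: Sw; rewrite leq_addl.
by rewrite -{1}[L]add0n big_addn big_mkord.
Qed.

Lemma universal_sequence (A : {linear Z -> Z}) (z : int -> Z) :
  separable Z -> bounded_operator A ->
  (forall n : int, A (z n) = z (n + 1)) ->
  closed_span [set z (- n) | n in [set: int]] = [set: Z] ->
  (exists F : set int, finite_set F /\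
    closed_span [set z (- n) | n in ~` F] <> [set: Z]) ->
  unconditionally_convergent (fun n : int => z (- n)) ->
  (exists r : int, z r = 0) ->
  universal_for_ergodic_systems R A.
Proof.
move=> sepZ bA Az spanT [F [finF spanF]] ucv [r0 zr0] d X mu T stdX ergT.
have [C AC] := bounded_lipschitz bA.
have z_ge r : z r = 0 -> forall k : nat, z (r + k%:Z) = 0.
  move=> zr; elim=> [|k IHk]; first by rewrite addr0.
  by rewrite -addn1 PoszD addrA -Az IHk linear0.
have [u0 nu0] : exists u, ~ closed_span [set z (- n) | n in ~` F] u.
  apply: contrapT => /forallNP H; apply: spanF.
  by apply/seteqP; split => // u _; apply: contrapT; exact: H.
(* If every [z n] vanished, [Z] would be zero and every closed span would contain [u0], against
   [nu0]. *)
have exk : exists k : nat, z (r0 - 1 - k%:Z) != 0.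
  apply: contrapT => /forallNP z0.
  have {}z0 n : z n = 0.
    have [r0n|nr0] := leP r0 n.
      have -> : n = r0 + (absz (n - r0)%R)%:Z by lia.
      exact: z_ge.
    have -> : n = r0 - 1 - (absz (r0 - 1 - n)%R)%:Z by lia.
    by apply/eqP; apply: contrapT => /negP; exact: z0.
  apply: nu0; apply/closed_spanP => e e0.
  have /closed_spanP/(_ e e0)[v [m [a [s [sz ->]]]] h] :
    closed_span [set z (- n) | n in [set: int]] u0 by rewrite spanT.
  exists 0; last first.
    move: h; rewrite big1// => i _; have [n _ <-] := sz i.
    by rewrite z0 scaler0.
  by exists 0%N, (fun=> 0), (fun=> 0); split; [case|rewrite big_ord0].
have [k1 zk1 k1min] := ex_minnP exk.
(* The first zero of the sequence: by minimality of [k1], [z r] is zero while [z (r - 1)] is not. *)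
pose r := r0 - k1%:Z.
have zr : z r = 0.
  rewrite /r; case: k1 {zk1 r} k1min => [|k] k1min; first by rewrite subr0.
  have -> : r0 - k.+1%:Z = r0 - 1 - k%:Z by lia.
  by apply/eqP; apply: contrapT => /negP /k1min; rewrite ltnn.
pose w (k : nat) := z (r - 1 - k%:Z).
have w00 : w 0%N != 0.
  by rewrite /w (_ : r - 1 - 0%N%:Z = r0 - 1 - k1%:Z)// /r; lia.
have Aw0 : A (w 0%N) = 0.
  by rewrite /w Az (_ : r - 1 - 0%N%:Z + 1 = r)//; lia.
have AwS k : A (w k.+1) = w k.
  by rewrite /w Az; congr z; lia.
have wP n : z n = 0 \/ exists k, z n = w k.
  have [rn|nr] := leP r n.
    left; have -> : n = r + (absz (n - r)%R)%:Z by lia.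
    exact: z_ge.
  by right; exists (absz (r - 1 - n)%R); rewrite /w; congr z; lia.
have w_sub : small_subsums ofR w.
  apply: small_subsums_rearrangement => // s [s' ss' s's].
  (* A rearrangement [s] of the natural numbers is extended to an enumeration of the integers by
     interleaving: even places carry the vectors [w (s j)], odd places the vectors [z (r + j)], all
     zero. Partial sums of even length are then those of [w] along [s]. *)
  pose t (j : nat) : int :=
    if odd j then - r - (j./2)%:Z else (s j./2)%:Z + 1 - r.
  have bt : bijective t.
    exists (fun n : int => if 1 - r <= n then (s' (absz (n + r - 1)%R)).*2
      else (absz (- r - n)%R).*2.+1).
      move=> j; rewrite /t; case: (boolP (odd j)) => oj.
        have -> : (1 - r <= - r - (j./2)%:Z) = false by lia.
        have -> : absz (- r - (- r - (j./2)%:Z))%R = j./2 by lia.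
        by rewrite -[RHS]odd_double_half oj add1n.
      have -> : 1 - r <= (s j./2)%:Z + 1 - r by lia.
      have -> : absz ((s j./2)%:Z + 1 - r + r - 1)%R = s j./2 by lia.
      by rewrite ss' -[RHS]odd_double_half (negbTE oj) add0n.
    move=> n; case: (boolP (1 - r <= n)) => nr; rewrite /t.
      by rewrite odd_double doubleK s's; lia.
    by rewrite /= odd_double /= uphalf_double; lia.
  have /cvg_ex[l /(rlim_cvgn ofRP) lP] := ucv _ bt.
  exists l => e e0; have [n nP] := lP e e0; exists n => m nm.
  have <- : series (fun k => z (- t k)) m.*2 = \sum_(0 <= j < m) w (s j).
    elim: m {nm} => [|m IHm]; first by rewrite /series /= !big_geq.
    rewrite doubleS seriesSr seriesSr IHm big_nat_recr//= -addrA; congr (_ + _).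
    rewrite /t /= odd_double /= doubleK uphalf_double.
    have -> : - (- r - m%:Z) = r + m%:Z by lia.
    by rewrite z_ge// addr0 /w; congr z; lia.
  by apply: nP; rewrite -addnn; apply: leq_trans nm (leq_addr _ _).
have spanW : linear_span [set z (- n) | n in [set: int]] `<=` tail_span w 0.
  apply: linear_span_tail => _ [n _ <-].
  by case: (wP (- n)) => [->|[k ->]]; [exact: tail_span0|exact: tail_span_w].
have w_dense (y : Z) (e : R) : 0 < e ->
    exists N (a : nat -> K), `[\sum_(0 <= k < N) a k *: w k - y] <= e.
  move=> e0; have /closed_spanP/(_ e e0)[v /spanW[N [a ->]] /ltW h] :
    closed_span [set z (- n) | n in [set: int]] y by rewrite spanT.
  by exists N, a.
(* In the family [z (- n)] the vector [w k] has index [n = k + 1 - r], which for [k >= L] is larger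
   in absolute value than every element of [F]. *)
have [L FL] : exists L : nat, forall k, (L <= k)%N -> (~` F) (k%:Z + 1 - r).
  have /finite_seqP[s Fs] := finF.
  exists (\max_(n <- s) absz (n)%R + absz (r)%R)%N => k Lk; rewrite Fs /= => ns.
  have := @leq_bigmax_seq _ s xpredT (fun n : int => absz (n)%R) _ ns isT.
  by move: Lk; set M := \max_(_ <- _) _; lia.
have tailF : tail_span w L `<=` linear_span [set z (- n) | n in ~` F].
  apply: tail_linear_span => k /FL nF; exists (k%:Z + 1 - r) => //.
  by rewrite /w; congr z; lia.
(* [p] is positive at [u0]. Were it zero at every [w k], it would vanish on their dense span and,
   being dominated by the norm, everywhere. *)
have w_head : exists k, head_norm ofR w L (w k) != 0.
  have /existsNP[e /not_implyP[e0 eP]] := contra_not (closed_spanP _ u0).2 nu0.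
  have ue : e <= head_norm ofR w L u0.
    apply: lb_le_inf; first by exists `[u0 - 0], 0 => //; exact: tail_span0.
    move=> _ [v /tailF Fv <-]; rewrite leNgt; apply/negP => h.
    by apply: eP; exists v => //; rewrite rnormBC.
  apply: contrapT => /forallNP pw0.
  have e20 : 0 < e / 2 by rewrite divr_gt0.
  have [N [a aP]] := w_dense u0 _ e20.
  have p0 : head_norm ofR w L (\sum_(0 <= k < N) a k *: w k) = 0.
    elim/big_ind: _ => [|x y x0 y0|k _].
    - by apply: head_norm_span => //; exact: tail_span0.
    - apply/eqP; rewrite eq_le head_norm_ge0// andbT.
      by apply: le_trans (head_normD ofRP _ _ _ _) _; rewrite x0 y0 addr0.
    - apply/eqP; rewrite eq_le head_norm_ge0// andbT.
      apply: le_trans (head_normZ ofRP _ _ _ _) _.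
      by have /negP := pw0 k; rewrite negbK => /eqP ->; rewrite mulr0.
  move: ue; apply/negP; rewrite -ltNge.
  set v := \sum_(_ <= _ < _) _ in aP p0.
  rewrite -[u0](subKr v); apply: le_lt_trans (head_normB ofRP _ _ _ _) _.
  rewrite p0 add0r; apply: le_lt_trans (head_norm_ler ofRP _ _ _) _.
  by apply: le_lt_trans aP _; rewrite ltr_pdivrMr// ltr_pMr// ltr1n.
exact: (universal_model ofRP AC Aw0 AwS w00 w_sub w_dense w_head ergT stdX sepZ).
Qed.

End two_sided.

Lemma real_embedding_id (R : realType) : real_embedding (idfun : {rmorphism R -> R}).
Proof. by split => // k _; exists k. Qed.

Lemma real_embedding_complex (R : realType) :
  real_embedding (real_complex R : {rmorphism R -> R[i]}).
Proof.
split => [x y|k k0]; first exact: lecR.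
by exists (complex.Re k); rewrite [RHS]complexE ger0_Im// mulr0 addr0.
Qed.

Unset Implicit Arguments.

Theorem theorem1p4 (R : realType) :
  (forall (Z : completeNormedModType R) (A : {linear Z -> Z}) (z : int -> Z),
     separable Z ->
     bounded_operator A ->
     (forall n : int, A (z n) = z (n + 1)) ->
     closed_span [set z (- n) | n in [set: int]] = [set: Z] ->
     (exists F : set int, finite_set F /\
        closed_span [set z (- n) | n in ~` F] <> [set: Z]) ->
     unconditionally_convergent (fun n : int => z (- n)) ->
     (exists r : int, z r = 0) ->
     universal_for_ergodic_systems R A)
  /\
  (forall (Z : completeNormedModType R[i]) (A : {linear Z -> Z})
      (z : int -> Z),
     separable Z ->
     bounded_operator A ->
     (forall n : int, A (z n) = z (n + 1)) ->
     closed_span [set z (- n) | n in [set: int]] = [set: Z] ->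
     (exists F : set int, finite_set F /\
        closed_span [set z (- n) | n in ~` F] <> [set: Z]) ->
     unconditionally_convergent (fun n : int => z (- n)) ->
     (exists r : int, z r = 0) ->
     universal_for_ergodic_systems R A).
Proof.
split => Z A z.
  exact: (universal_sequence (real_embedding_id R)).
exact: (universal_sequence (real_embedding_complex R)).
Qed.
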